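(* Assume $d\ge2$. Let $w\in\mathbb{R}^d$ be a centered random vector with four finite moments whose covariance matrix $K:=\mathbb{E}[ww^{\mathsf t}]$ has full rank. For a constant $\beta\ge1$, assume that $$\mathrm{Var}[\langle w,a\rangle^2]\le\beta^2\cdot(\mathrm{Var}[\langle w,a\rangle])^2\quad\text{for all }a\in\mathbb{R}^d.$$ For parameters $\varepsilon,p\in(0,1)$, suppose that the number $n$ of samples satisfies $$n\ge\frac{26\,\beta^2\,\max\{d,\log(d/p)\}}{\varepsilon^2}.$$ Then, with probability at least $1-p$, the sample covariance matrix $$\widehat K_n:=\frac1n\sum_{i=1}^nw_iw_i^{\mathsf t},\quad\text{where } w_1,\dots,w_n\text{ are iid copies of }w,$$ satisfies $$a^{\mathsf t}\widehat K_na\ge(1-\varepsilon)\cdot a^{\mathsf t}Ka\quad\text{for all }a\in\mathbb{R}^d.$$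
   Context: $\langle\cdot,\cdot\rangle$ is the standard inner product on $\mathbb{R}^d$, and ${}^{\mathsf t}$ denotes the transpose. *)

(* Defs.v *)
From HB Require Import structures.
From mathcomp Require Import all_boot all_order all_algebra.
From mathcomp Require Import all_classical all_reals all_analysis.

Set Implicit Arguments.
Unset Strict Implicit.
Unset Printing Implicit Defensive.
Import Order.TTheory GRing.Theory Num.Theory.
Import numFieldNormedType.Exports.
Local Open Scope classical_set_scope.
Local Open Scope ring_scope.

(* A random vector in R^d is a measurable map into [d.-tuple R], whose library
   sigma-algebra is the product one, i.e. the Borel sigma-algebra of R^d. The
   linear algebra is done on the associated column vectors. *)
Definition colv (R : realType) (d : nat) (v : d.-tuple R) : 'cV[R]_d :=
  \col_i tnth v i.

Definition dotv (R : realType) (d : nat) (u v : 'cV[R]_d) : R :=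
  \sum_(i < d) u i 0 * v i 0.

Definition normv (R : realType) (d : nat) (u : 'cV[R]_d) : R :=
  Num.sqrt (dotv u u).

Definition quadform (R : realType) (d : nat) (M : 'M[R]_d) (a : 'cV[R]_d) : R :=
  (a^T *m M *m a) 0 0.

(* The entrywise expectation E[w w^T]. [fine] loses nothing when the second
   moments of w are finite. *)
Definition covmx (R : realType) (d : nat)
    (disp : measure_display) (S : measurableType disp) (Q : probability S R)
    (w : {RV Q >-> d.-tuple R}) : 'M[R]_d :=
  \matrix_(i, j) fine 'E_Q[fun s => (colv (w s) *m (colv (w s))^T) i j].

Definition sample_covmx (R : realType) (d n : nat)
    (disp : measure_display) (T : measurableType disp) (P : probability T R)
    (ws : 'I_n -> {RV P >-> d.-tuple R}) (t : T) : 'M[R]_d :=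
  n%:R^-1 *: \sum_(i < n) colv (ws i t) *m (colv (ws i t))^T.

Definition mutually_independent (R : realType) (d n : nat)
    (disp : measure_display) (T : measurableType disp) (P : probability T R)
    (ws : 'I_n -> {RV P >-> d.-tuple R}) : Prop :=
  forall (J : {set 'I_n}) (B : 'I_n -> set (d.-tuple R)),
    (forall i, i \in J -> measurable (B i)) ->
    P (\bigcap_(i in [set` J]) (ws i @^-1` B i)) =
    (\prod_(i in J) P (ws i @^-1` B i))%E.

(* The copies may live on another probability space than w. *)
Definition iid_copies (R : realType) (d n : nat)
    (dispS : measure_display) (S : measurableType dispS) (Q : probability S R)
    (w : {RV Q >-> d.-tuple R})
    (dispT : measure_display) (T : measurableType dispT) (P : probability T R)
    (ws : 'I_n -> {RV P >-> d.-tuple R}) : Prop :=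
  mutually_independent ws /\
  forall (i : 'I_n) (B : set (d.-tuple R)), measurable B ->
    distribution P (ws i) B = distribution Q w B.

(* Main.v *)
(* After whitening, let x = C^T w, so that E[x x^T] = 1 and
   E<x,k>^4 <= H |k|^4 with H = 2 beta^2.  For an integer vector k consider
   Y_k = (<x,k>^2 - |x|^2 / 4) / (1 + |x|^2 / (d M)).  The truncation makes the
   exponential moments of -Y_k computable from fourth moments of x alone, so a
   Chernoff bound and a union bound, with weights prod_j 3^-1 2^-|k_j|, show
   that with probability 1 - p all the sums sum_i Y_k(x_i), for k in a box, are
   simultaneously large.
   To pass from integer vectors to an arbitrary v with |v|^2 = 15 d / 4, average
   over a random rounding k of v with independent coordinates, mean v and
   coordinate variance exactly 1/4: the average of <x,k>^2 - |x|^2 / 4 is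
   <x,v>^2, whereas |k|^2, |k|^4 and |k|_1 have explicit averages.  This plays
   the role of a PAC-Bayesian argument and needs no covering number. *)
Require Import Defs.
From HB Require Import structures.
From mathcomp Require Import all_boot all_order all_algebra.
From mathcomp Require Import ring lra zify.
From mathcomp Require Import all_classical all_reals all_analysis.
From mathcomp Require Import measurable_realfun.

Set Implicit Arguments.
Unset Strict Implicit.
Unset Printing Implicit Defensive.
Import Order.TTheory GRing.Theory Num.Theory.
Import numFieldNormedType.Exports.
Local Open Scope classical_set_scope.
Local Open Scope ring_scope.

Local Notation "''E_' P [ X ]" := (@expectation _ _ _ P X) : ring_scope.

(** * Quadratic bounds for the exponential function *)

Lemma expR_ge1DxDx2 (R : realType) (x : R) :
  0 <= x -> 1 + x + x ^+ 2 / 2 <= expR x.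
Proof.
move=> x0; rewrite /expR.
have -> : 1 + x + x ^+ 2 / 2 = series (exp_coeff x) 3.
  rewrite /series /= /exp_coeff /= !big_nat_recr //= big_geq // add0r.
  by rewrite !factS fact0 !expr0 expr1 !muln1 divr1 mulr1n divr1.
apply: nondecreasing_cvgn_le; last exact: is_cvg_series_exp_coeff.
by apply/nondecreasing_seqP => n; rewrite seriesSr lerDl exp_coeff_ge0.
Qed.

(** The quadratics in [- y] and in [y] multiply to [1 + y ^+ 4 / 4], which is at least 1, so the
    lower bound for [expR y] can be inverted. *)
Lemma expRN_le_quadratic (R : realType) (y : R) :
  0 <= y -> expR (- y) <= 1 - y + y ^+ 2 / 2.
Proof.
move=> y0; rewrite expRN; have h := expR_ge1DxDx2 y0.
have e0 := expR_gt0 y.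
rewrite -[leLHS]mul1r ler_pdivrMr //.
apply: le_trans (_ : (1 - y + y ^+ 2 / 2) * (1 + y + y ^+ 2 / 2) <= _).
  have -> : (1 - y + y ^+ 2 / 2) * (1 + y + y ^+ 2 / 2) = 1 + (y ^+ 2 / 2) ^+ 2.
    by field.
  by rewrite lerDl sqr_ge0.
by rewrite ler_wpM2l //; nra.
Qed.

(** Inverting [1 - x <= expR (- x)] gives [(1 - x) * expR x <= 1]; the quadratic times [1 - x]
    exceeds 1 by [x ^+ 2 * (1 - 2 * x)], which is where [x <= 2^-1] enters. *)
Lemma expR_le_quadratic (R : realType) (x : R) :
  0 <= x <= 2^-1 -> expR x <= 1 + x + 2 * x ^+ 2.
Proof.
move=> /andP[x0 x1].
have h : 1 - x <= (expR x)^-1 by rewrite -expRN; exact: expR_ge1Dx.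
have e0 := expR_gt0 x.
have h1 : (1 - x) * expR x <= 1 by rewrite -ler_pdivlMr // div1r.
have x2 : 0 < 1 - x by lra.
rewrite -(ler_pM2l x2); apply: le_trans h1 _.
rewrite -subr_ge0 (_ : _ - 1 = x ^+ 2 * (1 - 2 * x)); last by ring.
by rewrite mulr_ge0 ?sqr_ge0 //; lra.
Qed.

(* Negative values of [y := A - B] are only of size [B], which is what keeps
   the correction at order [B ^+ 2]. *)
Lemma expRN_sub_le (R : realType) (A B : R) :
  0 <= A -> 0 <= B <= 2^-1 ->
  expR (- (A - B)) <= 1 - (A - B) + A ^+ 2 / 2 + 2 * B ^+ 2.
Proof.
move=> A0 /andP[B0 B1]; have [AB|AB] := leP B A.
  have y0 : 0 <= A - B by lra.
  apply: le_trans (expRN_le_quadratic y0) _.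
  have : (A - B) ^+ 2 <= A ^+ 2 by rewrite ler_sqr ?nnegrE //; lra.
  have := sqr_ge0 B; lra.
rewrite opprB; apply: le_trans (expR_le_quadratic _) _; first by lra.
have : (B - A) ^+ 2 <= B ^+ 2 by rewrite ler_sqr ?nnegrE //; lra.
have := sqr_ge0 A; lra.
Qed.

(** * Random rounding to the integer lattice *)

(* Quadratic B-spline weights at -1, 0, 1: for |f| <= 1/2 they give mean f and
   variance 1/4, whatever f is. *)
Definition spline3 (R : realType) (f : R) (s : 'I_3) : R :=
  if val s is 0%N then (2^-1 - f) ^+ 2 / 2
  else if val s is 1%N then 3 / 4 - f ^+ 2
  else (2^-1 + f) ^+ 2 / 2.

Section rounding.
Context (R : realType) (d : nat) (f : 'I_d -> R) (m : 'I_d -> int).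
Hypothesis f2 : forall j, `|f j| <= 2^-1.

Definition rounding_weight (s : {ffun 'I_d -> 'I_3}) : R :=
  \prod_j spline3 (f j) (s j).
Definition rounding (s : {ffun 'I_d -> 'I_3}) (j : 'I_d) : int :=
  m j + (s j)%:Z - 1.

Lemma spline3_ge0 j s : 0 <= spline3 (f j) s.
Proof.
have := f2 j; rewrite ler_norml => /andP[h1 h2].
rewrite /spline3; case: (val s) => [|[|k]].
- by rewrite divr_ge0 // sqr_ge0.
- nra.
- by rewrite divr_ge0 // sqr_ge0.
Qed.

Lemma rounding_weight_ge0 s : 0 <= rounding_weight s.
Proof. by apply: prodr_ge0 => j _; exact: spline3_ge0. Qed.

Let E1 j (g : int -> R) := \sum_(s < 3) spline3 (f j) s * g (m j + s%:Z - 1).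

Let E1E j g : E1 j g = (2^-1 - f j) ^+ 2 / 2 * g (m j - 1)
  + (3 / 4 - f j ^+ 2) * g (m j) + (2^-1 + f j) ^+ 2 / 2 * g (m j + 1).
Proof.
rewrite /E1 !big_ord_recr big_ord0 /= add0r.
by congr (_ * g _ + _ * g _ + _ * g _); ring.
Qed.

(** Independence of the coordinates, obtained by distributing a product of sums over all choices
    [s]. Setting most factors to 1 yields the averages over one or two coordinates below. *)
Lemma rounding_prod (g : 'I_d -> int -> R) :
  \sum_s rounding_weight s * \prod_j g j (rounding s j) = \prod_j E1 j (g j).
Proof.
rewrite /E1 bigA_distr_bigA /=; apply: eq_bigr => s _.
by rewrite -big_split.
Qed.

Let E1_1 j : E1 j (fun=> 1) = 1.
Proof. by rewrite E1E; field. Qed.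

Lemma rounding_weight_sum : \sum_s rounding_weight s = 1.
Proof.
have := rounding_prod (fun _ _ => 1).
rewrite (eq_bigr rounding_weight) => [->|s _]; last by rewrite big1 // mulr1.
by rewrite big1 // => j _; rewrite E1_1.
Qed.

Lemma rounding_expect1 (g : int -> R) (j : 'I_d) :
  \sum_s rounding_weight s * g (rounding s j) = E1 j g.
Proof.
have := rounding_prod (fun i => if i == j then g else fun=> 1).
rewrite [RHS](bigD1 j) //= eqxx.
rewrite [in RHS]big1 ?mulr1 => [<-|i /negPf ->]; last exact: E1_1.
apply: eq_bigr => s _; rewrite (bigD1 j) //= eqxx big1 ?mulr1 // => i.
by move=> /negPf ->.
Qed.

Lemma rounding_expect2 (g h : int -> R) (i j : 'I_d) : i != j ->
  \sum_s rounding_weight s * (g (rounding s i) * h (rounding s j)) =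
  E1 i g * E1 j h.
Proof.
move=> ij; have ji : (j == i) = false by rewrite eq_sym; exact: negbTE.
have := rounding_prod
  (fun l => if l == i then g else if l == j then h else fun=> 1).
rewrite [RHS](bigD1 i) //= eqxx [in RHS](bigD1 j) ?ji //= eqxx.
rewrite [in RHS]big1 => [|l /andP[/negPf -> /negPf ->]]; last exact: E1_1.
rewrite mulr1 => <-; apply: eq_bigr => s _.
rewrite (bigD1 i) //= eqxx (bigD1 j) ?ji //= eqxx.
by rewrite big1 ?mulr1 // => l /andP[/negPf -> /negPf ->].
Qed.

Let v j : R := (m j)%:~R + f j.

Let E1_X j : E1 j (fun k => k%:~R) = v j.
Proof. by rewrite E1E /v !rmorphD /= !rmorphN /=; field. Qed.

Let E1_X2 j : E1 j (fun k => k%:~R ^+ 2) = v j ^+ 2 + 4^-1.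
Proof. by rewrite E1E /v !rmorphD /= !rmorphN /=; field. Qed.

Let E1_X4 j : E1 j (fun k => k%:~R ^+ 4) <=
  (v j ^+ 2 + 4^-1) ^+ 2 + 2 * v j ^+ 2 + 4^-1.
Proof.
have := f2 j; rewrite ler_norml => /andP[h1 h2].
have f1 : f j ^+ 2 <= 4^-1 by nra.
(* [q] is the third central moment of the rounded coordinate. Completing the square in [v j] absorbs
   its cross term, and [|f j| <= 1 / 2] gives [4 * q ^+ 2 <= 1 / 16]. *)
set q := f j * (4^-1 - f j ^+ 2).
rewrite -subr_ge0 E1E [X in 0 <= X](_ : _ = (v j - 2 * q) ^+ 2 +
  (16^-1 - 4 * q ^+ 2) + f j ^+ 2 * (3 / 2 - 3 * f j ^+ 2)); last first.
  by rewrite /q /v !rmorphD /= !rmorphN /=; field.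
have f0 : 0 <= f j ^+ 2 by exact: sqr_ge0.
apply: addr_ge0; last by apply: mulr_ge0 => //; lra.
by apply: addr_ge0; [exact: sqr_ge0 | rewrite subr_ge0 /q exprMn; nra].
Qed.

(** Distinct coordinates factor, so only the diagonal departs from the squared mean: variances of
    independent terms add. *)
Lemma rounding_expect_sqr (g : 'I_d -> int -> R) :
  \sum_s rounding_weight s * (\sum_j g j (rounding s j)) ^+ 2 =
  (\sum_j E1 j (g j)) ^+ 2 +
  \sum_j (E1 j (fun k => g j k ^+ 2) - E1 j (g j) ^+ 2).
Proof.
transitivity (\sum_i \sum_j \sum_s
    rounding_weight s * (g i (rounding s i) * g j (rounding s j))).
  under [RHS]eq_bigr do rewrite exchange_big /=.
  rewrite exchange_big /=; apply: eq_bigr => s _.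
  rewrite expr2 mulr_suml mulr_sumr.
  by apply: eq_bigr => i _; rewrite !mulr_sumr.
rewrite expr2 mulr_suml -big_split /=; apply: eq_bigr => i _.
rewrite (bigD1 i) //= mulr_sumr [in RHS](bigD1 i) //=.
rewrite (eq_bigr (fun j => E1 i (g i) * E1 j (g j))); last first.
  by move=> j ji; rewrite (rounding_expect2 (g i) (g j)) // eq_sym.
rewrite (eq_bigr (fun s => rounding_weight s * g i (rounding s i) ^+ 2)) //.
by rewrite (rounding_expect1 (fun k => g i k ^+ 2)); ring.
Qed.

(** Every coordinate has variance 1/4 wherever [v] lies, so the excess over the square at [v]
    depends on [x] only. *)
Lemma rounding_expect_dot_sqr (x : 'I_d -> R) :
  \sum_s rounding_weight s * (\sum_j x j * (rounding s j)%:~R) ^+ 2 =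
  (\sum_j x j * v j) ^+ 2 + (\sum_j x j ^+ 2) / 4.
Proof.
rewrite (rounding_expect_sqr (fun j k => x j * k%:~R)) mulr_suml.
have E1Z j (c : R) g : E1 j (fun k => c * g k) = c * E1 j g.
  by rewrite !E1E; ring.
congr (_ ^+ 2 + _); apply: eq_bigr => j _; rewrite E1Z E1_X //.
have -> : E1 j (fun k => (x j * k%:~R) ^+ 2) = x j ^+ 2 * (v j ^+ 2 + 4^-1).
  by rewrite -E1_X2 -E1Z; apply: eq_bigr => s _; rewrite exprMn.
by ring.
Qed.

Lemma rounding_expect_norm2 :
  \sum_s rounding_weight s * \sum_j (rounding s j)%:~R ^+ 2 =
  \sum_j v j ^+ 2 + d%:R / 4.
Proof.
under eq_bigr do rewrite mulr_sumr.
rewrite exchange_big /=.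
under eq_bigr do rewrite (rounding_expect1 (fun k => k%:~R ^+ 2)) E1_X2.
by rewrite big_split /= sumr_const card_ord mulr_natl.
Qed.

Lemma rounding_expect_norm4 :
  \sum_s rounding_weight s * (\sum_j (rounding s j)%:~R ^+ 2) ^+ 2 <=
  (\sum_j v j ^+ 2 + d%:R / 4) ^+ 2 + 2 * (\sum_j v j ^+ 2) + d%:R / 4.
Proof.
rewrite (rounding_expect_sqr (fun _ k => k%:~R ^+ 2)).
have sum4 : \sum_(j < d) (4^-1 : R) = d%:R / 4.
  by rewrite sumr_const card_ord mulr_natl.
rewrite (eq_bigr _ (fun j _ => E1_X2 j)) big_split /= sum4 -addrA lerD2l.
rewrite -sum4 mulr_sumr -big_split; apply: ler_sum => j _ /=.
rewrite E1_X2 lerBlDl addrA; apply: le_trans (E1_X4 j).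
by apply: ler_sum => s _; rewrite -exprM.
Qed.

(** Averages [|t| <= t ^+ 2 / 4 + 1]. Equality holds at [|t| = 2], the root mean square of a
    coordinate when the mean square norm is [4 * d]. *)
Lemma rounding_expect_norm1 :
  \sum_s rounding_weight s * \sum_j `|(rounding s j)%:~R| <=
  (\sum_j v j ^+ 2 + d%:R / 4) / 4 + d%:R.
Proof.
have sum1 : \sum_(j < d) (1 : R) = d%:R by rewrite sumr_const card_ord.
have -> : (\sum_j v j ^+ 2 + d%:R / 4) / 4 + d%:R =
    \sum_s rounding_weight s * \sum_j ((rounding s j)%:~R ^+ 2 / 4 + 1).
  rewrite -rounding_expect_norm2 mulr_suml -[X in _ + X]mul1r.
  rewrite -[X in _ + X * _]rounding_weight_sum [X in _ + X]mulr_suml -big_split.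
  by apply: eq_bigr => s _; rewrite big_split /= sum1 -mulr_suml; ring.
apply: ler_sum => s _; apply: ler_wpM2l; first exact: rounding_weight_ge0.
apply: ler_sum => j _.
rewrite -[leRHS](_ : `|(rounding s j)%:~R| ^+ 2 / 4 + 1 = _).
  by set t := `|_|; have := sqr_ge0 (t / 2 - 1); lra.
by rewrite real_normK ?num_real.
Qed.

End rounding.

(* |v|^2 = 15 d / 4 gives the rounding mean square norm 4 d, mean fourth power
   at most 16 d^2 + 31 d / 4 and mean l1 norm at most 2 d. *)
Lemma lattice_to_sphere (R : realType) (d N : nat) (x : 'I_N -> 'I_d -> R)
    (tau : 'I_N -> R) (a b c e : R) :
  (forall i, 0 <= tau i) -> 0 <= c -> 0 <= e ->
  (forall k : 'I_d -> int, (forall j, `|k j| <= (2 * d + 2)%:Z) ->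
    a * \sum_j (k j)%:~R ^+ 2 - b - c * (\sum_j (k j)%:~R ^+ 2) ^+ 2
      - e * \sum_j `|(k j)%:~R|
    <= \sum_i tau i * ((\sum_j x i j * (k j)%:~R) ^+ 2
                       - (\sum_j x i j ^+ 2) / 4)) ->
  forall v : 'I_d -> R, \sum_j v j ^+ 2 = 15 / 4 * d%:R ->
  a * (4 * d%:R) - b - c * ((4 * d%:R) ^+ 2 + 31 / 4 * d%:R) - e * (2 * d%:R)
  <= \sum_i tau i * (\sum_j x i j * v j) ^+ 2.
Proof.
move=> tau0 c0 e0 hk v v2.
(* Adding 1/2 before the floor gives the nearest integer, hence the bound on [f] that keeps the
   spline weights nonnegative. *)
pose m j : int := Num.floor (v j + 2^-1).
pose f j : R := v j - (m j)%:~R.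
have f2 j : `|f j| <= 2^-1.
  rewrite ler_norml /f; have /andP[h1 h2] := floor_itv (v j + 2^-1).
  by move: h2; rewrite intrD -/(m j) => h2; rewrite /m in h1 h2 *; lra.
have vE j : (m j)%:~R + f j = v j by rewrite /f addrC subrK.
have d0 : 0 <= d%:R :> R by exact: ler0n.
have vd j : `|v j| <= 2 * d%:R.
  have d1 : 1 <= d%:R :> R by rewrite ler1n (leq_ltn_trans _ (ltn_ord j)).
  have : v j ^+ 2 <= 15 / 4 * d%:R.
    by rewrite -v2 (bigD1 j) //= lerDl sumr_ge0 // => i _; exact: sqr_ge0.
  rewrite -(real_normK (num_real (v j))).
  set t := `|v j|; have t0 : 0 <= t by exact: normr_ge0.
  nra.
pose W := rounding_weight f; pose K := rounding m (d := d).
(* A rounded coordinate is within 3/2 of [v j], hence strictly below [2 * d + 3] in absolute value;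
   integrality then gives the half-width [2 * d + 2]. *)
have Kd s j : `|K s j| <= (2 * d + 2)%:Z.
  have : `|(K s j)%:~R : R| < (2 * d + 3)%:R.
    rewrite /K /rounding !rmorphD rmorphN /=.
    have := vd j; have := f2 j; rewrite -(vE j) !ler_norml ltr_norml.
    have s2 : ((s j)%:~R : R) <= 2 by rewrite (ler_nat R _ 2) -ltnS ltn_ord.
    have s0 : 0 <= ((s j)%:~R : R) by exact: ler0n.
    move=> /andP[? ?] /andP[? ?]; rewrite ?natrD ?natrM; lra.
  by rewrite -intr_norm -[X in _ < X]/((2 * d + 3)%:Z%:~R) ltr_int; lia.
have W0 s : 0 <= W s by apply: rounding_weight_ge0.
have W1 : \sum_s W s = 1 by apply: rounding_weight_sum.
have vEs : \sum_j ((m j)%:~R + f j) ^+ 2 = 15 / 4 * d%:R.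
  by rewrite -v2; apply: eq_bigr => j _; rewrite vE.
have n2 := rounding_expect_norm2 f m.
have n4 := rounding_expect_norm4 m f2.
have n1 := rounding_expect_norm1 m f2.
rewrite vEs -/W -/K in n1 n2 n4.
have : \sum_s W s * (a * \sum_j (K s j)%:~R ^+ 2 - b
      - c * (\sum_j (K s j)%:~R ^+ 2) ^+ 2 - e * \sum_j `|(K s j)%:~R|) <=
    \sum_s W s * \sum_i tau i * ((\sum_j x i j * (K s j)%:~R) ^+ 2
                       - (\sum_j x i j ^+ 2) / 4).
  by apply: ler_sum => s _; apply: ler_wpM2l => //; exact: hk.
(* The subtracted quarter of the squared norm of [x i] cancels the rounding variance exactly. *)
have -> : \sum_s W s * \sum_i tau i * ((\sum_j x i j * (K s j)%:~R) ^+ 2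
      - (\sum_j x i j ^+ 2) / 4) = \sum_i tau i * (\sum_j x i j * v j) ^+ 2.
  under eq_bigr do rewrite mulr_sumr.
  rewrite exchange_big /=; apply: eq_bigr => i _.
  rewrite (eq_bigr (fun s => tau i * (W s * (\sum_j x i j * (K s j)%:~R) ^+ 2
      - W s * ((\sum_j x i j ^+ 2) / 4)))); last by move=> s _; ring.
  rewrite -mulr_sumr sumrB -mulr_suml W1 mul1r; congr (_ * _).
  rewrite rounding_expect_dot_sqr addrK.
  by congr (_ ^+ 2); apply: eq_bigr => j _; rewrite vE.
apply: le_trans.
(* The terms in [a] and [b] average exactly; since [c] and [e] are nonnegative, upper bounds on the
   other two averages suffice. *)
rewrite (eq_bigr (fun s => a * (W s * \sum_j (K s j)%:~R ^+ 2) - b * W s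
      - c * (W s * (\sum_j (K s j)%:~R ^+ 2) ^+ 2)
      - e * (W s * \sum_j `|(K s j)%:~R|))); last by move=> s _; ring.
rewrite !sumrB -!mulr_sumr W1 n2 mulr1.
apply: lerB; last by apply: ler_wpM2l => //; apply: le_trans n1 _; lra.
apply: lerB; last by apply: ler_wpM2l => //; apply: le_trans n4 _; lra.
by rewrite lerD2r; lra.
Qed.

(** * Independent copies *)

Lemma prod_indic (R : realType) (T : Type) (I : finType) (A : I -> set T) x :
  \prod_i \1_(A i) x = \1_(\bigcap_(i in [set: I]) A i) x :> R.
Proof.
rewrite indicE; have [/set_mem xA|xA] := boolP (x \in _).
  by apply: big1 => i _; rewrite indicE mem_set //; exact: xA.
have [i xi] : exists i, ~ A i x.
  by apply/existsNP => h; move/negP: xA; apply; apply/mem_set => i _; exact: h.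
by rewrite (bigD1 i) //= indicE memNset // mul0r.
Qed.

Section iid.
Context (R : realType) (d n : nat)
  (dispS : measure_display) (S : measurableType dispS) (Q : probability S R)
  (w : {RV Q >-> d.-tuple R})
  (dispT : measure_display) (T : measurableType dispT) (P : probability T R)
  (ws : 'I_n -> {RV P >-> d.-tuple R}).
Hypothesis hiid : iid_copies w ws.

Lemma iid_prob_rect (B : 'I_n -> set (d.-tuple R)) :
  (forall i, measurable (B i)) ->
  P (\bigcap_(i in [set: 'I_n]) (ws i @^-1` B i)) =
  (\prod_i Q (w @^-1` B i))%E.
Proof.
move=> mB; have [ind eqd] := hiid.
have := ind [set: 'I_n]%SET B (fun i _ => mB i).
rewrite (_ : [set` [set: 'I_n]%SET] = [set: 'I_n]) => [->|]; last first.
  by apply/seteqP; split => i //= _; rewrite inE.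
rewrite (eq_bigl xpredT) => [|i]; last by rewrite inE.
by apply: eq_bigr => i _; exact: eqd.
Qed.

Lemma measurable_RV_comp (F : d.-tuple R -> R) i :
  measurable_fun setT F -> measurable_fun setT (fun t => F (ws i t)).
Proof. by move=> mF; apply: measurableT_comp. Qed.

(** For nonnegative combinations of indicators the expanded product involves only probabilities of
    rectangles, which is what independence of events controls. *)
Lemma iid_expectation_prod_simple (N : nat) (c : 'I_N -> R)
    (B : 'I_N -> set (d.-tuple R)) :
  (forall j, 0 <= c j) -> (forall j, measurable (B j)) ->
  let g y := \sum_j c j * \1_(B j) y in
  'E_P[fun t => \prod_i g (ws i t)] = (fine 'E_Q[fun s => g (w s)] ^+ n)%:E.
Proof.
move=> c0 mB g.
pose q j := fine (Q (w @^-1` B j)).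
have mwB j : measurable (w @^-1` B j) by exact: measurable_funPTI.
have mwsB i j : measurable (ws i @^-1` B j) by exact: measurable_funPTI.
have qE j : Q (w @^-1` B j) = (q j)%:E by rewrite fineK // fin_num_measure.
have -> : 'E_Q[fun s => g (w s)] = (\sum_j c j * q j)%:E.
  rewrite unlock /g -sumEFin.
  under eq_integral do rewrite -sumEFin.
  rewrite ge0_integral_sum //=; last 2 first.
  - move=> j; apply/measurable_EFinP; apply: measurable_funM => //.
    exact: (measurable_indic (mwB j)).
  - by move=> j s _; rewrite lee_fin mulr_ge0.
  apply: eq_bigr => j _; rewrite EFinM -qE.
  under eq_integral do rewrite EFinM.
  rewrite ge0_integralZl ?lee_fin //; last first.
    apply/measurable_EFinP; exact: (measurable_indic (mwB j)).
  by congr (_ * _)%E; rewrite -[X in _ = Q X]setIT -integral_indic.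
have mcap (phi : {ffun 'I_n -> 'I_N}) :
    measurable (\bigcap_(i in [set: 'I_n]) (ws i @^-1` B (phi i))).
  by apply: fin_bigcap_measurable.
have gE t : \prod_i g (ws i t) = \sum_(phi : {ffun 'I_n -> 'I_N})
    (\prod_i c (phi i)) *
    \1_(\bigcap_(i in [set: 'I_n]) (ws i @^-1` B (phi i))) t.
  rewrite /g bigA_distr_bigA /=; apply: eq_bigr => phi _.
  rewrite big_split /=; congr (_ * _).
  rewrite -prod_indic; apply: eq_bigr => i _; rewrite !indicE.
  by congr (_%:R); congr nat_of_bool; apply/idP/idP; rewrite !inE.
rewrite unlock; under eq_integral do rewrite gE -sumEFin.
rewrite ge0_integral_sum //=; last 2 first.
- by move=> phi; apply/measurable_EFinP; apply: measurable_funM.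
- by move=> phi t _; rewrite lee_fin mulr_ge0 ?prodr_ge0.
have -> : ((\sum_j c j * q j) ^+ n)%:E =
    (\sum_(phi : {ffun 'I_n -> 'I_N}) (\prod_i (c (phi i) * q (phi i)))%R%:E)%E.
  rewrite sumEFin; congr EFin.
  rewrite -(bigA_distr_bigA (fun (_ : 'I_n) j => c j * q j)) /=.
  by rewrite prodr_const card_ord.
apply: eq_bigr => phi _.
under eq_integral do rewrite EFinM.
rewrite ge0_integralZl ?lee_fin ?prodr_ge0 //; last first.
  apply/measurable_EFinP; exact: (measurable_indic (mcap phi)).
rewrite integral_indic ?setIT //.
have /= -> := @iid_prob_rect (fun i => B (phi i)) (fun i => mB (phi i)).
rewrite big_split /= EFinM; congr (_ * _)%E.
by rewrite -prodEFin; apply: eq_bigr => i _.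
Qed.

(** A bounded [F] is dominated by a step function exceeding it by at most [eta], to which the
    preceding identity applies; then [eta] tends to 0. *)
Lemma iid_expectation_prod_le (F : d.-tuple R -> R) (C m : R) :
  measurable_fun setT F -> (forall y, 0 <= F y <= C) ->
  ('E_Q[fun s => F (w s)] <= m%:E)%E ->
  ('E_P[fun t => (\prod_i F (ws i t))%R] <= (m ^+ n)%:E)%E.
Proof.
move=> mF F0C Em.
have m0 : 0 <= m.
  rewrite -lee_fin; apply: le_trans Em; apply: expectation_ge0 => s.
  by have /andP[] := F0C (w s).
have step (eta : R) : 0 < eta ->
    ('E_P[fun t => (\prod_i F (ws i t))%R] <= ((m + eta) ^+ n)%:E)%E.
  move=> eta0.
  (* Enough half-open cells of length [eta] to cover the interval from 0 to [C], endpoint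
     included. *)
  pose N := (Num.truncn (C / eta)).+1.
  pose B (j : 'I_N) := [set y | j%:R * eta <= F y < j.+1%:R * eta].
  have mB j : measurable (B j).
    rewrite (_ : B j = F @^-1` `[j%:R * eta, j.+1%:R * eta[%classic).
      by rewrite -[X in measurable X]setTI; apply: mF.
    by apply/seteqP; split => y /=; rewrite in_itv.
  have c0 (j : 'I_N) : 0 <= j.+1%:R * eta by rewrite mulr_ge0 // ltW.
  (* Each cell carries its upper endpoint, so [g] lies above [F]. *)
  pose g y := \sum_(j < N) j.+1%:R * eta * \1_(B j) y.
  have gF y : F y <= g y <= F y + eta.
    have /andP[F0 FC] := F0C y.
    have Fe0 : 0 <= F y / eta by rewrite divr_ge0 // ltW.
    have jN : (Num.truncn (F y / eta) < N)%N.
      by rewrite ltnS; apply: le_truncn; rewrite ler_pM2r ?invr_gt0.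
    have By j : B j y <-> j = Ordinal jN.
      rewrite /B /= -ler_pdivlMr // -ltr_pdivrMr //; split.
        by move=> h; apply/val_inj/esym/eqP; rewrite /= truncn_eq.
      by move=> -> /=; exact: truncn_itv.
    rewrite /g (bigD1 (Ordinal jN)) //= big1 ?addr0 => [|j jn]; last first.
      rewrite indicE memNset ?mulr0 // => /By jj.
      by rewrite jj eqxx in jn.
    have BB : B (Ordinal jN) y by apply/By.
    rewrite indicE mem_set // mulr1.
    by move: BB; rewrite /B /= -natr1 mulrDl mul1r => /andP[h1 h2]; lra.
  have mg : measurable_fun setT g.
    by apply: measurable_sum => j; apply: measurable_funM.
  have FP t : 0 <= \prod_i F (ws i t) <= \prod_i g (ws i t).
    have h i : 0 <= F (ws i t) <= g (ws i t).
      by have /andP[-> _] := F0C (ws i t); have /andP[-> _] := gF (ws i t).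
    rewrite prodr_ge0 => [/=|i _]; last by have /andP[] := h i.
    by apply: ler_prod => i _; exact: h.
  have mFw i : measurable_fun setT (fun t => F (ws i t)).
    exact: measurable_RV_comp.
  have mgw i : measurable_fun setT (fun t => g (ws i t)).
    exact: measurable_RV_comp.
  apply: (@le_trans _ _ ('E_P[fun t => (\prod_i g (ws i t))%R])%E).
    apply: expectation_le.
    - exact: measurable_prod.
    - exact: measurable_prod.
    - by move=> t; have /andP[] := FP t.
    - by move=> t; have /andP[] := FP t; exact: le_trans.
    - by apply/aeW => t; have /andP[] := FP t.
  rewrite (iid_expectation_prod_simple c0 mB) lee_fin.
  have Eg : ('E_Q[fun s => g (w s)] <= (m + eta)%:E)%E.
    apply: (@le_trans _ _ ('E_Q[fun s => (F (w s) + eta)%R])%E).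
      apply: expectation_le.
      - exact: measurableT_comp.
      - by apply: measurable_funD => //; exact: measurableT_comp.
      - move=> s; have /andP[h1 _] := F0C (w s).
        by have /andP[h2 _] := gF (w s); lra.
      - by move=> s; have /andP[h1 _] := F0C (w s); lra.
      - by apply/aeW => s; have /andP[] := gF (w s).
    rewrite unlock; under eq_integral do rewrite EFinD.
    rewrite ge0_integralD //=; last 3 first.
    - by move=> s _; rewrite lee_fin; have /andP[] := F0C (w s).
    - by apply/measurable_EFinP; exact: measurableT_comp.
    - by move=> s _; rewrite lee_fin ltW.
    have -> : (\int[Q]_(_ in [set: S]) eta%:E = eta%:E)%E.
      by have := expectation_cst Q eta; rewrite unlock.
    rewrite EFinD leeD2r //.
    by move: Em; rewrite unlock.
  have Eg0 : (0 <= 'E_Q[fun s => g (w s)])%E.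
    apply: expectation_ge0 => s.
    have /andP[h1 _] := F0C (w s); have /andP[h2 _] := gF (w s); lra.
  rewrite lerXn2r ?nnegrE ?fine_ge0 ?addr_ge0 ?(ltW eta0) //.
  rewrite -lee_fin fineK // ge0_fin_numE //.
  by apply: le_lt_trans Eg _; rewrite ltry.
(* Continuity of the [n]-th power at [m] lets the mesh tend to 0. *)
apply/lee_addgt0Pr => e e0.
have /(_ m) cX := @exprn_continuous R n.
have /cvgrPdist_lt /(_ _ e0) [del /= del0 hdel] := cX.
have del2 : 0 < del / 2 by rewrite divr_gt0.
apply: le_trans (step _ del2) _.
rewrite -EFinD lee_fin.
have := hdel (m + del / 2).
rewrite /ball_ /= opprD addNKr normrN gtr0_norm // => /(_ _).
rewrite ltr_norml => /(_ ltac:(lra)) /andP[h _]; lra.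
Qed.

(** Markov's inequality for the exponential of minus the sum. The lower bound on [g] only serves to
    bound [expR (- g)], as the product estimate requires. *)
Lemma iid_chernoff (g : d.-tuple R -> R) (c mu s : R) :
  measurable_fun setT g -> (forall y, - c <= g y) ->
  ('E_Q[fun z => expR (- g (w z))] <= (expR (- mu))%:E)%E ->
  (P [set t | (\sum_i g (ws i t) < n%:R * mu - s)%R] <= (expR (- s))%:E)%E.
Proof.
move=> mg gc Em.
have mF : measurable_fun setT (fun y => expR (- g y)).
  by apply: measurableT_comp => //; exact: measurable_funN.
have F0C y : 0 <= expR (- g y) <= expR c.
  by rewrite expR_ge0 ler_expR lerNl gc.
have mgw i : measurable_fun setT (fun t => g (ws i t)).
  exact: measurable_RV_comp.
have := iid_expectation_prod_le mF F0C Em.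
rewrite -expRM_natl => h.
set A := [set t | _].
have mA : measurable A.
  rewrite (_ : A = (fun t => \sum_i g (ws i t)) @^-1`
    `]-oo, (n%:R * mu - s)[%classic).
    by rewrite -[X in measurable X]setTI; apply: measurable_sum.
  by apply/seteqP; split => t /=; rewrite in_itv.
rewrite -(expectation_indic P mA).
have E0 := expR_gt0 (n%:R * mu - s).
apply: (@le_trans _ _ ((expR (n%:R * mu - s))%:E *
    'E_P[fun t => (\prod_i expR (- g (ws i t)))%R])%E).
  rewrite unlock -ge0_integralZl ?lee_fin ?(ltW E0) //; last 2 first.
  - apply/measurable_EFinP; apply: measurable_prod => i _.
    by apply: measurableT_comp => //; exact: measurable_funN.
  - by move=> t _; rewrite lee_fin prodr_ge0 // => i _; exact: expR_ge0.
  apply: ge0_le_integral => //.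
  - by apply/measurable_EFinP; exact: measurable_indic.
  - apply: measurable_funeM; apply/measurable_EFinP.
    apply: measurable_prod => i _.
    by apply: measurableT_comp => //; exact: measurable_funN.
  (* On [A] the exponent [n%:R * mu - s] minus the sum is positive, so the exponential dominates the
     indicator. *)
  move=> t _; rewrite -EFinM lee_fin indicE -expR_sum -expRD.
  have [/set_mem At|_] := boolP (t \in A); last exact: expR_ge0.
  apply: ltW; rewrite -[ltLHS]/(1 : R) expR_gt1 sumrN.
  by move: At; rewrite /A /=; lra.
apply: le_trans (lee_wpmul2l _ h) _; first by rewrite lee_fin ltW.
by rewrite -EFinM -expRD lee_fin ler_expR; lra.
Qed.

End iid.

(** * Moments *)

Section ge0_expectation.
Context (R : realType) (disp : measure_display) (S : measurableType disp)
  (Q : probability S R).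

Lemma ge0_expectationD (f g : S -> R) :
  measurable_fun setT f -> (forall x, 0 <= f x) ->
  measurable_fun setT g -> (forall x, 0 <= g x) ->
  'E_Q[fun x => f x + g x] = ('E_Q[f] + 'E_Q[g])%E.
Proof.
move=> mf f0 mg g0; rewrite unlock; under eq_integral do rewrite EFinD.
by apply: ge0_integralD => // [x _||x _|]; rewrite ?lee_fin //;
  exact/measurable_EFinP.
Qed.

Lemma ge0_expectationZl (k : R) (f : S -> R) :
  measurable_fun setT f -> (forall x, 0 <= f x) -> 0 <= k ->
  'E_Q[fun x => k * f x] = (k%:E * 'E_Q[f])%E.
Proof.
move=> mf f0 k0; rewrite unlock; under eq_integral do rewrite EFinM.
by rewrite ge0_integralZl // => [|x _]; rewrite ?lee_fin //;
  exact/measurable_EFinP.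
Qed.

Lemma ge0_expectation_sum (I : Type) (r : seq I) (f : I -> S -> R) :
  (forall i, measurable_fun setT (f i)) -> (forall i x, 0 <= f i x) ->
  'E_Q[fun x => \sum_(i <- r) f i x] = (\sum_(i <- r) 'E_Q[f i])%E.
Proof.
move=> mf f0; rewrite unlock; under eq_integral do rewrite -sumEFin.
by rewrite ge0_integral_sum // => [i|i x _]; rewrite ?lee_fin //;
  exact/measurable_EFinP.
Qed.

Lemma ge0_expectation_le (f g : S -> R) :
  measurable_fun setT f -> (forall x, 0 <= f x) -> measurable_fun setT g ->
  (forall x, f x <= g x) -> ('E_Q[f] <= 'E_Q[g])%E.
Proof.
move=> mf f0 mg fg; apply: expectation_le => //.
- by move=> x; apply: le_trans (fg x).
- exact/aeW.
Qed.

End ge0_expectation.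

Lemma measurable_inv_gt0 (R : realType) (disp : measure_display)
    (S : measurableType disp) (f : S -> R) :
  measurable_fun setT f -> (forall x, 0 < f x) ->
  measurable_fun setT (fun x => (f x)^-1).
Proof.
move=> mf f0.
rewrite (_ : (fun x => _) = (fun x => expR (- ln (f x)))); last first.
  by apply/funext => x; rewrite expRN lnK // posrE.
apply: measurableT_comp => //; apply: measurable_funN.
exact: (measurableT_comp (@measurable_ln R)).
Qed.

Lemma truncation_le (R : realFieldType) (b M : R) :
  0 <= b -> 0 < M -> b * (1 + b / M)^-1 <= M.
Proof.
move=> b0 M0; have t0 : 0 < 1 + b / M by rewrite ltr_pwDl // divr_ge0 // ltW.
rewrite ler_pdivrMr // mulrDr mulr1 mulrCA divff ?mulr1 ?gt_eqF //.
by rewrite lerDr ltW.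
Qed.

(* Truncating by [1 + b / M] keeps [b] bounded by [M] and costs only the
   cross term [U * b / M], controlled by second moments. *)
Lemma truncated_mgf_le (R : realType) (disp : measure_display)
    (S : measurableType disp) (Q : probability S R) (U b : S -> R)
    (s H M delta lambda : R) :
  measurable_fun setT U -> measurable_fun setT b ->
  (forall x, 0 <= U x) -> (forall x, 0 <= b x) ->
  0 <= s -> 0 <= H -> 0 < M -> 0 <= delta -> 0 <= lambda ->
  lambda * M * delta <= 2^-1 ->
  (s = 0 -> forall x, U x = 0) ->
  'E_Q[U] = s%:E -> ('E_Q[fun x => (U x ^+ 2)%R] <= (H * s ^+ 2)%:E)%E ->
  'E_Q[b] = 1%:E -> ('E_Q[fun x => (b x ^+ 2)%R] <= H%:E)%E ->
  ('E_Q[fun x => (expR (- (lambda * ((U x - b x * delta) / (1 + b x / M)))))%R] <=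
   (expR (- (lambda * (s * (1 - H / M) - delta)
     - lambda ^+ 2 * H * (s ^+ 2 / 2 + 2 * delta ^+ 2))))%:E)%E.
Proof.
move=> mU mb U0 b0 s0 H0 M0 de0 la0 lM sU EU EU2 Eb Eb2.
have iM : 0 <= M^-1 by rewrite invr_ge0 ltW.
have is0 : 0 <= s^-1 by rewrite invr_ge0.
pose c1 := lambda * delta.
pose c2 := lambda * (s / (2 * M)) + 2 * lambda ^+ 2 * delta ^+ 2.
pose c3 := lambda * (s^-1 / (2 * M)) + lambda ^+ 2 / 2.
have c10 : 0 <= c1 by rewrite mulr_ge0.
have M20 : 0 <= (2 * M)^-1 by rewrite invr_ge0 mulr_ge0 // ltW.
have c20 : 0 <= c2 by rewrite /c2 addr_ge0 // ?mulr_ge0 // sqr_ge0.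
have c30 : 0 <= c3 by rewrite /c3 addr_ge0 // ?mulr_ge0 // ?divr_ge0 // sqr_ge0.
set Y := fun x => expR _.
have tau x : 0 < 1 + b x / M by rewrite ltr_pwDl // mulr_ge0.
(* Keeping [lambda * U x] on the left makes both sides nonnegative, so expectations add without any
   integrability condition. The negative part of the exponent is at most 1/2 because
   [b x * t <= M]. *)
have pw x : Y x + lambda * U x <=
    1 + c1 * b x + (c2 * b x ^+ 2 + c3 * U x ^+ 2).
  rewrite /Y; set t := (1 + b x / M)^-1.
  have t0 : 0 <= t by rewrite invr_ge0 ltW.
  have t1 : t <= 1 by rewrite invf_le1 // lerDl mulr_ge0.
  have tb : b x * t <= M by exact: truncation_le.
  have t2 : 1 - b x / M <= t.
    rewrite -[t]mul1r ler_pdivlMr // -subr_ge0.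
    by rewrite [X in 0 <= X](_ : _ = (b x / M) ^+ 2) ?sqr_ge0 //; ring.
  have -> : lambda * ((U x - b x * delta) * t) =
      lambda * U x * t - lambda * delta * (b x * t) by ring.
  have A0 : 0 <= lambda * U x * t by rewrite !mulr_ge0.
  have B0 : 0 <= lambda * delta * (b x * t) <= 2^-1.
    rewrite !mulr_ge0 //=; apply: le_trans lM.
    by rewrite [leRHS]mulrAC; apply: ler_wpM2l; rewrite ?mulr_ge0.
  have := expRN_sub_le A0 B0.
  have hA : (lambda * U x * t) ^+ 2 <= lambda ^+ 2 * U x ^+ 2.
    by rewrite -exprMn ler_sqr ?nnegrE ?mulr_ge0 // ler_piMr // mulr_ge0.
  have hB : (lambda * delta * (b x * t)) ^+ 2 <=
      lambda ^+ 2 * delta ^+ 2 * b x ^+ 2.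
    rewrite -!exprMn ler_sqr ?nnegrE ?mulr_ge0 //.
    by rewrite ler_wpM2l ?mulr_ge0 // ler_piMr.
  have hB1 : lambda * delta * (b x * t) <= c1 * b x.
    by rewrite ler_wpM2l ?mulr_ge0 // ler_piMr.
  have hA1 : lambda * U x * (1 - b x / M) <= lambda * U x * t.
    by rewrite ler_wpM2l ?mulr_ge0.
  (* The arithmetic-geometric inequality with weight [s] balances the bounds [H] on the second
     moment of [b] and [H * s ^+ 2] on that of [U]. When [s = 0], [U] vanishes. *)
  have cross : U x * b x <= (s * b x ^+ 2 + s^-1 * U x ^+ 2) / 2.
    have [s00|sn0] := eqVneq s 0.
      by rewrite sU // s00 mul0r expr0n /= mulr0 mul0r addr0 mul0r.
    have spos : 0 < s by rewrite lt_neqAle eq_sym sn0.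
    rewrite -subr_ge0 [X in 0 <= X](_ : _ = s^-1 * (s * b x - U x) ^+ 2 / 2).
      by rewrite mulr_ge0 // mulr_ge0 // sqr_ge0.
    by field.
  have cr : lambda / M * (U x * b x) <=
      lambda / M * ((s * b x ^+ 2 + s^-1 * U x ^+ 2) / 2).
    by rewrite ler_wpM2l // mulr_ge0.
  have -> : c2 * b x ^+ 2 + c3 * U x ^+ 2 =
     lambda / M * ((s * b x ^+ 2 + s^-1 * U x ^+ 2) / 2) +
     2 * (lambda ^+ 2 * delta ^+ 2 * b x ^+ 2) + lambda ^+ 2 * U x ^+ 2 / 2.
    by rewrite /c2 /c3 invfM; ring.
  have -> : lambda * U x =
      lambda * U x * (1 - b x / M) + lambda / M * (U x * b x).
    by ring.
  lra.
have mi : measurable_fun setT (fun x => (1 + b x / M)^-1).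
  apply: measurable_inv_gt0 => //.
  by apply: measurable_funD => //; exact: measurable_funM.
have mY : measurable_fun setT Y.
  apply: measurableT_comp => //; apply: measurable_funN.
  apply: measurable_funM => //; apply: measurable_funM => //.
  by apply: measurable_funB => //; exact: measurable_funM.
have Y0 x : 0 <= Y x by exact: expR_ge0.
have mb2 : measurable_fun setT (fun x => b x ^+ 2) by exact: measurable_funX.
have mU2 : measurable_fun setT (fun x => U x ^+ 2) by exact: measurable_funX.
have mlU : measurable_fun setT (fun x => lambda * U x) by exact: measurable_funM.
have m1 : measurable_fun setT (fun x => c1 * b x) by exact: measurable_funM.
have m2 : measurable_fun setT (fun x => c2 * b x ^+ 2) by exact: measurable_funM.
have m3 : measurable_fun setT (fun x => c3 * U x ^+ 2) by exact: measurable_funM.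
have m11 : measurable_fun setT (fun x => 1 + c1 * b x) by exact: measurable_funD.
have m23 : measurable_fun setT (fun x => c2 * b x ^+ 2 + c3 * U x ^+ 2).
  exact: measurable_funD.
have lU0 x : 0 <= lambda * U x by rewrite mulr_ge0.
have p1 x : 0 <= c1 * b x by rewrite mulr_ge0.
have p2 x : 0 <= c2 * b x ^+ 2 by rewrite mulr_ge0 // sqr_ge0.
have p3 x : 0 <= c3 * U x ^+ 2 by rewrite mulr_ge0 // sqr_ge0.
have : ('E_Q[fun x => (Y x + lambda * U x)%R] <=
    'E_Q[fun x => (1 + c1 * b x + (c2 * b x ^+ 2 + c3 * U x ^+ 2))%R])%E.
  apply: ge0_expectation_le => //.
  - exact: measurable_funD.
  - by move=> x; rewrite addr_ge0.
  - exact: measurable_funD.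
rewrite !ge0_expectationD // ?ge0_expectationZl //; last first.
- by move=> x; rewrite addr_ge0.
- by move=> x; rewrite addr_ge0.
- by move=> x; rewrite sqr_ge0.
- by move=> x; rewrite sqr_ge0.
rewrite EU Eb (expectation_cst Q 1) mule1 -EFinM => h.
have : ('E_Q[Y] + (lambda * s)%:E <=
    (1 + c1 + (c2 * H + c3 * (H * s ^+ 2)))%:E)%E.
  apply: le_trans h _; rewrite !EFinD !(EFinM c2) (EFinM c3).
  by rewrite leeD2l // leeD // lee_wpmul2l // lee_fin.
rewrite -leeBrDr // -EFinB => h1; apply: le_trans h1 _; rewrite lee_fin.
apply: le_trans (expR_ge1Dx _).
suff : c3 * (H * s ^+ 2) =
    lambda * (s / (2 * M)) * H + lambda ^+ 2 * H * (s ^+ 2 / 2).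
  move=> ->; rewrite /c1 /c2 invfM le_eqVlt; apply/orP; left; apply/eqP.
  by field; lra.
(* At [s = 0] the inverse takes its default value 0, and both sides vanish. *)
rewrite /c3; have [->|sn0] := eqVneq s 0; first by rewrite invr0; ring.
by rewrite invfM; field; rewrite sn0 gt_eqF.
Qed.

(** Cauchy-Schwarz: the residual of [u] after projection on [v] has nonnegative squared norm. *)
Lemma sum_mul_sqr_le (R : realFieldType) (I : finType) (u v : I -> R) :
  (\sum_i u i * v i) ^+ 2 <= (\sum_i u i ^+ 2) * (\sum_i v i ^+ 2).
Proof.
set A := \sum_i v i ^+ 2; set C := \sum_i u i * v i.
have A0 : 0 <= A by apply: sumr_ge0 => i _; exact: sqr_ge0.
have [A00|An0] := eqVneq A 0.
  suff -> : C = 0 by rewrite A00 expr0n /= mulr0.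
  rewrite /C big1 // => i _; suff -> : v i = 0 by rewrite mulr0.
  apply/eqP; rewrite -sqrf_eq0; move/eqP: A00.
  by rewrite psumr_eq0 => [/allP/(_ i (mem_index_enum i))|j _]; rewrite ?sqr_ge0.
have Apos : 0 < A by rewrite lt_neqAle eq_sym An0.
rewrite -ler_pdivrMr // -subr_ge0.
have -> : \sum_i u i ^+ 2 - C ^+ 2 / A = \sum_i (u i - C / A * v i) ^+ 2.
  rewrite [RHS](eq_bigr (fun i => u i ^+ 2 - 2 * C / A * (u i * v i)
    + (C / A) ^+ 2 * v i ^+ 2)); last by move=> i _; field.
  by rewrite big_split sumrB /= -!mulr_sumr -/A -/C; field.
by apply: sumr_ge0 => i _; exact: sqr_ge0.
Qed.

(** * Second and fourth moments of linear forms *)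

Lemma quadformE (R : realType) (d : nat) (M : 'M[R]_d) (a : 'cV[R]_d) :
  quadform M a = \sum_i \sum_j a i 0 * M i j * a j 0.
Proof.
rewrite /quadform -mulmxA mxE; apply: eq_bigr => i _; rewrite !mxE mulr_sumr.
by apply: eq_bigr => j _; rewrite mulrA.
Qed.

Lemma dotv_colv (R : realType) (d : nat) (y : d.-tuple R) (a : 'cV[R]_d) :
  dotv (colv y) a = \sum_i tnth y i * a i 0.
Proof. by apply: eq_bigr => i _; rewrite mxE. Qed.

Lemma measurable_dotv (R : realType) (d : nat) (a : 'cV[R]_d) :
  measurable_fun setT (fun y : d.-tuple R => dotv (colv y) a).
Proof.
under eq_fun do rewrite dotv_colv.
apply: measurable_sum => i; apply: measurable_funM => //; exact: measurable_tnth.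
Qed.

Section moments.
Context (R : realType) (d : nat)
  (dispS : measure_display) (S : measurableType dispS) (Q : probability S R)
  (w : {RV Q >-> d.-tuple R}).
Hypothesis hmom4 : ('E_Q[fun s => (normv (colv (w s)) ^+ 4)%R] < +oo)%E.

Let N (s : S) : R := dotv (colv (w s)) (colv (w s)).

Let N0 s : 0 <= N s.
Proof. by apply: sumr_ge0 => i _; rewrite -expr2 sqr_ge0. Qed.

Let mw i : measurable_fun setT (fun s => tnth (w s) i).
Proof. exact: (measurableT_comp (measurable_tnth i) (measurable_funPT w)). Qed.

Let mN : measurable_fun setT N.
Proof.
rewrite /N; under eq_fun do rewrite dotv_colv.
apply: measurable_sum => i; under eq_fun do rewrite mxE.
exact: measurable_funM.
Qed.

Let mdot a : measurable_fun setT (fun s => dotv (colv (w s)) a).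
Proof. exact: (measurableT_comp (measurable_dotv a) (measurable_funPT w)). Qed.

(** [N] is the squared norm, so [1 + N s ^+ 2] is integrable by the fourth moment. This one
    dominating function serves every integrability claim of the section. *)
Lemma integrable_le_norm4 (f : S -> R) (C : R) : measurable_fun setT f ->
  (forall s, `|f s| <= C * (1 + N s ^+ 2)) -> Q.-integrable setT (EFin \o f).
Proof.
move=> mf fC.
have I4 : Q.-integrable setT (EFin \o (fun s => N s ^+ 2)).
  apply/integrableP; split.
    by apply/measurable_EFinP; exact: measurable_funX.
  move: hmom4; rewrite unlock; congr (_ < _)%E; apply: eq_integral => s _ /=.
  by rewrite ger0_norm ?sqr_ge0 // /normv -[4%N]/(2 * 2)%N exprM sqr_sqrtr // N0.
have Ig : Q.-integrable setT (EFin \o (fun s => C * (1 + N s ^+ 2))).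
  apply: (eq_integrable measurableT (fun s => C%:E * (1%:E + (N s ^+ 2)%:E))%E) => //.
  apply: integrableZl => //; apply: integrableD => //.
  exact: finite_measure_integrable_cst.
apply: (le_integrable measurableT _ _ Ig); first exact/measurable_EFinP.
by move=> s _ /=; rewrite lee_fin; apply: le_trans (fC s) (ler_norm _).
Qed.

Let N1 s : N s <= 1 + N s ^+ 2.
Proof. by have := sqr_ge0 (N s - 1); have := N0 s; nra. Qed.

Let tnth2 s i : tnth (w s) i ^+ 2 <= N s.
Proof.
rewrite /N dotv_colv (bigD1 i) //= mxE -expr2 lerDl.
by apply: sumr_ge0 => j _; rewrite mxE -expr2 sqr_ge0.
Qed.

Let Itnth i : Q.-integrable setT (EFin \o (fun s => tnth (w s) i)).
Proof.
apply: (@integrable_le_norm4 _ 2) => // s.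
have := tnth2 s i; have := N1 s; rewrite -(real_normK (num_real (tnth _ _))).
set t := `|_|; have := sqr_ge0 (t - 1); nra.
Qed.

Let Itnth2 i j : Q.-integrable setT (EFin \o (fun s => tnth (w s) i * tnth (w s) j)).
Proof.
apply: (@integrable_le_norm4 _ 1); first exact: measurable_funM.
move=> s; have := tnth2 s i; have := tnth2 s j; have := N1 s; rewrite normrM.
rewrite -(real_normK (num_real (tnth _ i))) -(real_normK (num_real (tnth _ j))).
set t := `|_|; set u := `|_|; have := sqr_ge0 (t - u); nra.
Qed.

Lemma expectation_dotv2 (a : 'cV[R]_d) :
  'E_Q[fun s => dotv (colv (w s)) a ^+ 2] = (quadform (covmx w) a)%:E.
Proof.
(* Integrability of the products makes the expectation finite, so [fine] can be undone. *)
have covE i j : 'E_Q[fun s => tnth (w s) i * tnth (w s) j] = (covmx w i j)%:E.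
  rewrite mxE; have -> : (fun s => (colv (w s) *m (colv (w s))^T) i j) =
      (fun s => tnth (w s) i * tnth (w s) j).
    by apply/funext => s; rewrite mxE big_ord1 !mxE.
  by rewrite fineK // expectation_fin_num //; exact/Lfun1_integrable.
rewrite quadformE -sumEFin unlock.
have -> : (fun s => (dotv (colv (w s)) a ^+ 2)%:E) = (fun s => \sum_i \sum_j
    ((a i 0 * a j 0)%:E * (tnth (w s) i * tnth (w s) j)%:E))%E.
  apply/funext => s; rewrite dotv_colv expr2 mulr_suml -sumEFin.
  apply: eq_bigr => i _; rewrite mulr_sumr -sumEFin; apply: eq_bigr => j _.
  by rewrite -EFinM; congr EFin; ring.
rewrite integral_sum //; last first.
  move=> i; apply: integrable_sum => // j _.
  by apply: integrableZl => //; exact: Itnth2.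
apply: eq_bigr => i _; rewrite integral_sum // => [|j]; last first.
  by apply: integrableZl => //; exact: Itnth2.
rewrite -sumEFin; apply: eq_bigr => j _; rewrite integralZl //; last exact: Itnth2.
by have := covE i j; rewrite unlock => ->; rewrite -EFinM mulrAC.
Qed.

Lemma quadform_covmx_ge0 (a : 'cV[R]_d) : 0 <= quadform (covmx w) a.
Proof.
by rewrite -lee_fin -expectation_dotv2 expectation_ge0 // => s; exact: sqr_ge0.
Qed.

Let dot2 a s : dotv (colv (w s)) a ^+ 2 <= dotv a a * N s.
Proof.
have sq (u : 'cV[R]_d) : dotv u u = \sum_i u i 0 ^+ 2.
  by apply: eq_bigr => i _; rewrite expr2.
by rewrite mulrC /N !sq; exact: sum_mul_sqr_le.
Qed.

Let aa0 (a : 'cV[R]_d) : 0 <= dotv a a.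
Proof. by apply: sumr_ge0 => i _; rewrite -expr2 sqr_ge0. Qed.

Lemma variance_dotv (a : 'cV[R]_d) :
  (forall j : 'I_d, 'E_Q[fun s => colv (w s) j 0] = 0%E) ->
  variance Q (fun s => dotv (colv (w s)) a) = (quadform (covmx w) a)%:E.
Proof.
move=> hc; set X := fun s => _.
have IX : Q.-integrable setT (EFin \o X).
  apply: (@integrable_le_norm4 _ (1 + dotv a a)); first exact: mdot.
  move=> s.
  have := dot2 a s; rewrite -/(X s) -(real_normK (num_real (X s))).
  set t := `|_|; have := sqr_ge0 (t - 1); have := N1 s; have := N0 s.
  have := aa0 a; nra.
have IX2 : Q.-integrable setT (EFin \o (X * X)).
  apply: (@integrable_le_norm4 _ (dotv a a)); first by apply: measurable_funM; exact: mdot.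
  move=> s; rewrite ger0_norm -expr2 ?sqr_ge0 //; apply: le_trans (dot2 a s) _.
  exact: ler_wpM2l.
have EX : 'E_Q[X] = 0%E.
  rewrite unlock /X.
  have -> : (fun s => (dotv (colv (w s)) a)%:E) = (fun s => \sum_i
      ((a i 0)%:E * (tnth (w s) i)%:E))%E.
    apply/funext => s; rewrite dotv_colv -sumEFin.
    by apply: eq_bigr => i _; rewrite -EFinM mulrC.
  rewrite integral_sum // => [|i]; last first.
    by apply: integrableZl => //; exact: Itnth.
  rewrite big1 // => i _; rewrite integralZl //; last exact: Itnth.
  have := hc i; have -> : (fun s => colv (w s) i 0) = (fun s => tnth (w s) i).
    by apply/funext => s; rewrite mxE.
  by rewrite unlock => ->; rewrite mule0.
rewrite /variance covarianceE; [|exact/Lfun1_integrable..].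
by rewrite EX mule0 sube0 -expectation_dotv2.
Qed.

Lemma variance_dotv2 (a : 'cV[R]_d) :
  variance Q (fun s => dotv (colv (w s)) a ^+ 2) =
  ('E_Q[fun s => (dotv (colv (w s)) a ^+ 4)%R] - (quadform (covmx w) a ^+ 2)%:E)%E.
Proof.
set X := fun s => _.
have IX : Q.-integrable setT (EFin \o X).
  apply: (@integrable_le_norm4 _ (dotv a a)); first by apply: measurable_funX; exact: mdot.
  move=> s; rewrite ger0_norm ?sqr_ge0 //; apply: le_trans (dot2 a s) _.
  exact: ler_wpM2l.
have IX2 : Q.-integrable setT (EFin \o (X * X)).
  apply: (@integrable_le_norm4 _ (dotv a a ^+ 2)).
    by apply: measurable_funM; apply: measurable_funX; exact: mdot.
  move=> s; rewrite ger0_norm -expr2 ?sqr_ge0 //.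
  apply: (@le_trans _ _ ((dotv a a * N s) ^+ 2)).
    by rewrite ler_sqr ?nnegrE ?sqr_ge0 ?mulr_ge0 ?aa0 ?N0 //; exact: dot2.
  by rewrite exprMn ler_wpM2l ?sqr_ge0 // lerDr.
rewrite /variance covarianceE; [|exact/Lfun1_integrable..].
rewrite expectation_dotv2 -EFinM -expr2; congr (_ - _)%E; congr expectation.
by apply/funext => s; rewrite -[4%N]/(2 * 2)%N exprM [RHS]expr2.
Qed.

(** The fourth moment is the variance of the square plus the squared second moment, hence at most
    [beta ^+ 2 + 1] times the latter; [1 <= beta] replaces this factor by [2 * beta ^+ 2]. *)
Lemma expectation_dotv4_le (beta : R) (a : 'cV[R]_d) : 1 <= beta ->
  (forall j : 'I_d, 'E_Q[fun s => colv (w s) j 0] = 0%E) ->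
  (variance Q (fun s => (dotv (colv (w s)) a ^+ 2)%R) <=
    (beta ^+ 2)%:E * variance Q (fun s => dotv (colv (w s)) a) ^+ 2)%E ->
  ('E_Q[fun s => (dotv (colv (w s)) a ^+ 4)%R] <=
    (2 * beta ^+ 2 * quadform (covmx w) a ^+ 2)%:E)%E.
Proof.
move=> b1 hc; rewrite variance_dotv // variance_dotv2 -EFin_expe -EFinM.
rewrite leeBlDr // -EFinD => h; apply: le_trans h _; rewrite lee_fin.
have : 1 <= beta ^+ 2 by rewrite exprn_ege1.
have := sqr_ge0 (quadform (covmx w) a); nra.
Qed.

End moments.

(** * Whitening and measurability of quadratic forms *)

(* Cholesky by induction on the Schur complement of the first entry. *)
Lemma posdef_whitening (R : rcfType) (d : nat) (M : 'M[R]_d) :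
  M^T = M -> (forall a : 'cV[R]_d, a != 0 -> 0 < (a^T *m M *m a) 0 0) ->
  exists C : 'M[R]_d, C^T *m M *m C = 1%:M.
Proof.
elim: d M => [|d IH]; first by move=> M _ _; exists 1%:M; apply/matrixP => - [].
rewrite -[d.+1]/(1 + d)%N => M symM posM.
pose r := @ursubmx _ 1 d 1 d M; pose N := @drsubmx _ 1 d 1 d M.
pose alpha := M 0 0.
have ME : M = block_mx (alpha%:M : 'M[R]_1) r r^T N :> 'M[R]_(1 + d).
  rewrite -[LHS](@submxK _ 1 d 1 d) -/r -/N; congr block_mx.
    rewrite [LHS]mx11_scalar; congr (_%:M); rewrite !mxE; congr (M _ _);
    exact: val_inj.
  by rewrite /r -{1}symM trmx_ursub.
have a0 : 0 < alpha.
  have := posM (delta_mx 0 0); rewrite trmx_delta -rowE -colE !mxE; apply.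
  by apply/eqP => /matrixP/(_ 0 0)/eqP; rewrite !mxE !eqxx oner_eq0.
have an0 : alpha != 0 by rewrite gt_eqF.
pose Sc := N - alpha^-1 *: (r^T *m r).
(* Block elimination: this choice of upper block annihilates the first row and leaves the Schur
   complement. It is used with a vector, for the positivity of [Sc], and with [C'], for the
   factorization. *)
have MC m (X : 'M[R]_(d, m)) : block_mx (alpha%:M : 'M[R]_1) r r^T N *m
    col_mx (- (alpha^-1 *: (r *m X))) X = col_mx 0 (Sc *m X).
  rewrite mul_block_col mul_scalar_mx mulmxN -scalemxAr scalerN scalerA.
  rewrite divff // scale1r addNr; congr col_mx.
  by rewrite /Sc mulmxBl -scalemxAl mulmxA addrC.
have symN : N^T = N by rewrite /N -{2}symM trmx_drsub.
have [||C' C'E] := IH Sc.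
- by rewrite /Sc linearB linearZ /= trmx_mul trmxK symN.
- move=> x xn0; pose y : 'cV_(1 + d) := col_mx (- (alpha^-1 *: (r *m x))) x.
  have yn0 : y != 0.
    apply: contra_neq xn0 => y0.
    by rewrite -(col_mxKd (- (alpha^-1 *: (r *m x))) x) -/y y0 linear0.
  have := posM y yn0; rewrite -mulmxA ME MC /y tr_col_mx mul_row_col mulmx0 add0r.
  by rewrite mulmxA.
pose s := (Num.sqrt alpha)^-1.
exists (block_mx (s%:M : 'M[R]_1) (- (alpha^-1 *: (r *m C'))) 0 C' : 'M[R]_(1 + d)).
rewrite -mulmxA ME block_mxEh mul_mx_row MC mul_block_col !mulmx0 !addr0.
rewrite tr_row_mx mul_col_row !tr_col_mx !mul_row_col.
rewrite !trmx0 !mul0mx !mulmx0 !addr0 !add0r.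
rewrite [X in block_mx _ _ _ X]mulmxA C'E.
rewrite [RHS](_ : _ = block_mx 1%:M 0 0 1%:M :> 'M[R]_(1 + d)); last first.
  exact: scalar_mx_block.
congr block_mx.
  rewrite tr_scalar_mx -!scalar_mxM; congr (_%:M).
  by rewrite /s -{2}(sqr_sqrtr (ltW a0)) expr2; field; rewrite sqrtr_eq0 -ltNge.
rewrite linearN linearZ /= trmx_mul mulNmx -scalar_mxM -!scalemxAl mulmxA.
by rewrite !mul_mx_scalar scalerA mulrA mulVf // mul1r addNr.
Qed.

(* Integer vectors make the universal quantification over [a] countable. *)
Lemma quadform_lt0_int (R : realType) (d : nat) (M : 'M[R]_d) (a : 'cV[R]_d) :
  quadform M a < 0 -> exists z : 'cV[int]_d, quadform M (map_mx intr z) < 0.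
Proof.
move=> q0.
pose C1 := \sum_i \sum_j `|M i j| * (`|a i 0| + `|a j 0|).
pose C2 := \sum_i \sum_j `|M i j|.
have C10 : 0 <= C1 by do 2![apply: sumr_ge0 => ? _]; rewrite mulr_ge0 // addr_ge0.
have C20 : 0 <= C2 by do 2![apply: sumr_ge0 => ? _].
(* Rounding [m * a] down changes the form by at most [m * C1 + C2], while [m ^+ 2 * quadform M a] is
   below [- m * (C1 + C2)] for this [m]; since [1 <= m], the negative term wins. *)
pose m : R := (Num.bound ((C1 + C2) / - quadform M a)).+1%:R.
have mq : C1 + C2 < m * - quadform M a.
  rewrite -ltr_pdivrMr ?oppr_gt0 //; apply: lt_trans (_ : (Num.bound ((C1 + C2) / - quadform M a))%:R < _); last by rewrite ltr_nat.
  by apply: archi_boundP; rewrite divr_ge0 ?addr_ge0 // oppr_ge0 ltW.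
have m1 : 1 <= m by rewrite ler1n.
exists (\col_i Num.floor (m * a i 0)).
pose f i : R := m * a i 0 - (Num.floor (m * a i 0))%:~R.
have f01 i : 0 <= f i <= 1.
  have /andP[h1 h2] := floor_itv (m * a i 0).
  by move: h2; rewrite intrD /f => h2; apply/andP; split; lra.
apply: (@le_lt_trans _ _ (m ^+ 2 * quadform M a + m * C1 + C2)); last by nra.
rewrite !quadformE /C1 /C2 !mulr_sumr -!big_split; apply: ler_sum => i _ /=.
rewrite !mulr_sumr -!big_split; apply: ler_sum => j _ /=.
rewrite !mxE.
have -> : (Num.floor (m * a i 0))%:~R = m * a i 0 - f i by rewrite /f; ring.
have -> : (Num.floor (m * a j 0))%:~R = m * a j 0 - f j by rewrite /f; ring.
have b1 : - (M i j * (a i 0 * f j + f i * a j 0)) <= `|M i j| * (`|a i 0| + `|a j 0|).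
  apply: le_trans (ler_norm _) _; rewrite normrN normrM ler_wpM2l //.
  apply: le_trans (ler_normD _ _) _; rewrite !normrM; have := f01 i; have := f01 j.
  move=> /andP[? ?] /andP[? ?]; rewrite (ger0_norm (x := f i)) // (ger0_norm (x := f j)) //.
  by rewrite lerD // ?ler_piMr // ler_piMl.
have b2 : M i j * (f i * f j) <= `|M i j|.
  apply: le_trans (ler_norm _) _; rewrite normrM ler_piMr //.
  have /andP[? ?] := f01 i; have /andP[? ?] := f01 j.
  by rewrite ger0_norm ?mulr_ge0 // mulr_ile1.
have -> : (m * a i 0 - f i) * M i j * (m * a j 0 - f j) =
  m ^+ 2 * (a i 0 * M i j * a j 0) + m * - (M i j * (a i 0 * f j + f i * a j 0))
   + M i j * (f i * f j) by ring.
by rewrite lerD // lerD2l ler_wpM2l //; lra.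
Qed.

(** An uncountable intersection over [a] becomes the complement of a countable union over integer
    vectors. *)
Lemma measurable_quadform_ge0 (R : realType) (d : nat) (disp : measure_display)
    (T : measurableType disp) (M : T -> 'M[R]_d) :
  (forall i j, measurable_fun setT (fun t => M t i j)) ->
  measurable [set t | forall a : 'cV[R]_d, 0 <= quadform (M t) a].
Proof.
move=> mM.
have -> : [set t | forall a : 'cV[R]_d, 0 <= quadform (M t) a] =
    ~` \bigcup_(z : 'cV[int]_d) [set t | quadform (M t) (map_mx intr z) < 0].
  apply/seteqP; split => t /=.
    by move=> h [z _] /=; rewrite ltNge h.
  move=> h a; rewrite leNgt; apply/negP => /quadform_lt0_int [z zq].
  by apply: h; exists z.
apply: measurableC; apply: countable_bigcupT_measurable => [|z]; first exact: countableP.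
rewrite (_ : [set _ | _] =
  (fun t => quadform (M t) (map_mx intr z)) @^-1` `]-oo, 0[%classic); last first.
  by apply/seteqP; split => t /=; rewrite in_itv.
rewrite -[X in measurable X]setTI.
suff mq : measurable_fun setT (fun t => quadform (M t) (map_mx intr z)) by apply: mq.
under eq_fun do rewrite quadformE.
apply: measurable_sum => i; apply: measurable_sum => j.
by apply: measurable_funM => //; exact: measurable_funM.
Qed.

(** * The union bound *)

(** The two-sided geometric series has total mass 3, whence the factor [3^-1] in the weights. *)
Lemma sum_geometric_box (R : realFieldType) (K : nat) :
  \sum_(i < (2 * K).+1) (2^-1 : R) ^+ `|i%:Z - K%:Z|%N = 3 - 2 * 2^-1 ^+ K.
Proof.
elim: K => [|K IH]; first by rewrite big_ord1 /= !expr0; ring.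
rewrite mulnS 2!addSn add0n big_ord_recl big_ord_recr /=.
rewrite (eq_bigr (fun i : 'I_(2 * K).+1 => 2^-1 ^+ `|i%:Z - K%:Z|%N)); last first.
  by move=> i _; congr (_ ^+ _); rewrite /bump /=; lia.
rewrite IH.
rewrite [X in 2^-1 ^+ X + (_ + _)](_ : _ = K.+1); last by lia.
rewrite [X in _ + (_ + 2^-1 ^+ X)](_ : _ = K.+1); last by rewrite /bump; lia.
by rewrite !exprS; field.
Qed.

Definition box_point (d K : nat) (g : {ffun 'I_d -> 'I_(2 * K).+1}) (j : 'I_d) : int :=
  (g j)%:Z - K%:Z.

Lemma box_pointP (d K : nat) (k : 'I_d -> int) :
  (forall j, `|k j| <= K%:Z) -> exists g : {ffun 'I_d -> 'I_(2 * K).+1},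
    box_point g =1 k.
Proof.
move=> kK; have kj j : (`|(k j + K%:Z)%R|%N < (2 * K).+1)%N by have := kK j; lia.
exists [ffun j => Ordinal (kj j)] => j; rewrite /box_point ffunE /=.
by have := kK j; lia.
Qed.

Lemma box_weight_sum_le1 (R : realFieldType) (d K : nat) :
  \sum_(g : {ffun 'I_d -> 'I_(2 * K).+1})
    \prod_j (3^-1 * 2^-1 ^+ `|box_point g j|%N) <= 1 :> R.
Proof.
rewrite -(bigA_distr_bigA (fun (_ : 'I_d) (i : 'I_(2 * K).+1) =>
  3^-1 * 2^-1 ^+ `|i%:Z - K%:Z|%N)) /=.
apply: prodr_ile1 => j _; rewrite -mulr_sumr sum_geometric_box.
have h : 0 <= (2^-1 : R) ^+ K by rewrite exprn_ge0.
have h1 : (2^-1 : R) ^+ K <= 1 by rewrite exprn_ile1 // invf_le1 // ler1n.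
by apply/andP; split; lra.
Qed.

(** The deviation allotted to [k] is minus the logarithm of [p] times its weight, so the failure
    probabilities sum to at most [p]. This is how the l1 norm of [k] enters. *)
Lemma expRN_box_weight (R : realType) (d : nat) (p : R) (k : 'I_d -> int) :
  0 < p ->
  expR (- (- ln p + d%:R * ln 3 + ln 2 * \sum_j `|(k j)%:~R|)) =
  p * \prod_j (3^-1 * 2^-1 ^+ `|k j|%N).
Proof.
move=> p0; rewrite -addrA opprD opprK expRD lnK //; congr (_ * _).
have -> : d%:R * ln 3 + ln 2 * \sum_j `|(k j)%:~R| =
    \sum_j (ln 3 + `|k j|%N%:R * ln 2) :> R.
  rewrite big_split /= sumr_const card_ord mulr_natl mulr_sumr; congr (_ + _).
  apply: eq_bigr => j _; rewrite mulrC; congr (_ * _).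
  by rewrite -intr_norm -abszE.
rewrite -sumrN expR_sum; apply: eq_bigr => j _.
by rewrite opprD expRD expRN lnK ?posrE // expRN expRM_natl lnK ?posrE // exprVn.
Qed.

(** The claim amounts to [12 ^ 4 <= e ^ 11], for which [5 / 2 <= e] is enough. *)
Lemma ln12_le (R : realType) : ln 3 + 2 * ln 2 <= 11 / 4 :> R.
Proof.
have e1 : 5 / 2 <= expR 1 :> R.
  by apply: le_trans (expR_ge1DxDx2 _) => //; lra.
suff : 4%:R * (ln 3 + 2%:R * ln 2) <= 11%:R * 1 :> R by lra.
rewrite -ler_expR !expRM_natl expRD expRM_natl !lnK ?posrE //.
apply: le_trans (_ : (5 / 2 : R) ^+ 11 <= _); last first.
  by rewrite lerXn2r ?nnegrE ?expR_ge0 //; lra.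
lra.
Qed.

(** * Sample quadratic forms, positive definiteness and the choice of constants *)

Lemma quadform_sample_covmx (R : realType) (d n : nat)
    (disp : measure_display) (T : measurableType disp) (P : probability T R)
    (ws : 'I_n -> {RV P >-> d.-tuple R}) (t : T) (a : 'cV[R]_d) :
  quadform (sample_covmx ws t) a = n%:R^-1 * \sum_i dotv (colv (ws i t)) a ^+ 2.
Proof.
rewrite /quadform /sample_covmx -scalemxAr -scalemxAl mxE; congr (_ * _).
rewrite mulmx_sumr mulmx_suml summxE; apply: eq_bigr => i _.
set u := colv _; have -> : a^T *m (u *m u^T) *m a = (a^T *m u) *m (u^T *m a).
  by rewrite !mulmxA.
rewrite mxE big_ord1.
have -> : (a^T *m u) 0 0 = dotv u a.
  by rewrite mxE; apply: eq_bigr => j _; rewrite mxE mulrC.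
rewrite expr2; congr (_ * _).
by rewrite mxE; apply: eq_bigr => j _; rewrite mxE.
Qed.

Lemma measure_bigcup_le_sum (R : realType) (disp : measure_display)
    (T : measurableType disp) (P : probability T R) (I : finType) (A : I -> set T) :
  (forall i, measurable (A i)) ->
  (P (\bigcup_i A i) <= \sum_i P (A i))%E.
Proof.
move=> mA.
have mU : measurable (\bigcup_i A i) by exact: fin_bigcup_measurable.
rewrite -(expectation_indic P mU).
under eq_bigr => i _ do rewrite -(expectation_indic P (mA i)).
rewrite -ge0_expectation_sum //.
apply: ge0_expectation_le => //; first by apply: measurable_sum => i; exact: (measurable_indic (mA i)).
move=> t; rewrite indicE; have [/set_mem [i _ Ait]|_] := boolP (t \in _).
  by rewrite (bigD1 i) //= indicE mem_set // lerDl sumr_ge0.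
by rewrite sumr_ge0.
Qed.

(** If the form vanished at [a], moving from [a] along minus [M *m a] would make it negative: the
    first-order change is [- 2 * t * cc], with [cc] the squared norm of [M *m a]. *)
Lemma posdef_of_psd (R : realFieldType) (d : nat) (M : 'M[R]_d) :
  M^T = M -> M \in unitmx -> (forall a : 'cV[R]_d, 0 <= (a^T *m M *m a) 0 0) ->
  forall a : 'cV[R]_d, a != 0 -> 0 < (a^T *m M *m a) 0 0.
Proof.
move=> symM uM M0 a an0; rewrite lt_neqAle M0 andbT eq_sym; apply/negP => /eqP qa.
pose c := M *m a.
pose cc := (c^T *m c) 0 0; pose q := (c^T *m M *m c) 0 0.
have cn0 : c != 0.
  by apply: contra_neq an0 => c0; rewrite -(mulKmx uM a) -/c c0 mulmx0.
have cc0 : 0 < cc.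
  have ccE : cc = \sum_i c i 0 ^+ 2.
    by rewrite /cc mxE; apply: eq_bigr => i _; rewrite mxE expr2.
  have s0 i : 0 <= c i 0 ^+ 2 by exact: sqr_ge0.
  rewrite lt_neqAle ccE sumr_ge0 // andbT eq_sym psumr_eq0 //.
  apply: contra cn0 => /allP h; apply/eqP/colP => i.
  have := h i (mem_index_enum i); rewrite /= sqrf_eq0 => /eqP ->.
  by rewrite mxE.
have q0 : 0 <= q by exact: M0.
(* With this step the form at [a - t *: c] equals [- t * cc - t ^+ 2]. *)
pose t := cc / (q + 1).
have q1 : 0 < q + 1 by lra.
have t0 : 0 < t by rewrite divr_gt0.
have := M0 (a - t *: c).
have aM : a^T *m M = c^T by rewrite /c trmx_mul symM.
have cM : c^T *m M *m a = c^T *m c by rewrite -mulmxA.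
have -> : (a - t *: c)^T = a^T - t *: c^T by rewrite linearB linearZ.
rewrite !mulmxBr !mulmxBl aM -!scalemxAl -!scalemxAr cM.
have subE (A B : 'M[R]_1) : (A - B) 0 0 = A 0 0 - B 0 0 by rewrite !mxE.
have scE (r : R) (A : 'M[R]_1) : (r *: A) 0 0 = r * A 0 0 by rewrite mxE.
rewrite !subE !scE -/cc -/q -[in (c^T *m a) 0 0]aM qa.
have tq : t * (q + 1) = cc by rewrite mulfVK // gt_eqF.
nra.
Qed.

(** Loss budget in units of [N * eps * D]: 1/3 from truncation, 1/48 and 4/3 from the second-order
    terms, 31/96 from the remaining fourth-power term using [2 <= D], and 45/26 from the union
    bound. The total stays below the 15/4 available. *)
Lemma final_constants (R : realFieldType) 
    (N D eps H lp l2 l3 m lambda M delta : R) :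
  0 <= N -> 2 <= D -> 0 < eps -> 0 < H -> D <= m -> lp <= m ->
  l3 + 2 * l2 <= 11 / 4 -> 13 * H * m <= N * eps ^+ 2 ->
  lambda = eps / (6 * H * D) -> M = 12 * H / eps -> delta = D / 4 ->
  N * (1 - eps) * (15 / 4 * D) <=
  N * (1 - H / M) * (4 * D)
  - (N * delta + 2 * N * lambda * H * delta ^+ 2 + (lp + D * l3) / lambda)
  - N * lambda * H / 2 * ((4 * D) ^+ 2 + 31 / 4 * D) - l2 / lambda * (2 * D).
Proof.
move=> N0 D2 e0 H0 Dm lpm l23 hN lE ME deE.
have D0 : 0 < D by lra.
pose T := 6 * H * D / eps * (lp + D * l3 + 2 * D * l2).
have -> : N * (1 - H / M) * (4 * D)
  - (N * delta + 2 * N * lambda * H * delta ^+ 2 + (lp + D * l3) / lambda)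
  - N * lambda * H / 2 * ((4 * D) ^+ 2 + 31 / 4 * D) - l2 / lambda * (2 * D) =
  N * (15 / 4 * D) - N * eps * (D * (1 / 3 + 1 / 48 + 4 / 3) + 31 / 48) - T.
  by rewrite /T deE ME lE; field; rewrite !gt_eqF.
have lpD : lp + D * l3 + 2 * D * l2 <= 15 / 4 * m by nra.
have hT : T <= 45 / 26 * (N * eps * D).
  have c0 : 0 <= 6 * H * D / eps by rewrite !mulr_ge0 ?invr_ge0 // ltW.
  apply: le_trans (ler_wpM2l c0 lpD) _.
  have -> : 6 * H * D / eps * (15 / 4 * m) = 45 / 26 * (13 * H * m) * D / eps.
    by field; rewrite gt_eqF.
  rewrite ler_pdivrMr //.
  have -> : 45 / 26 * (N * eps * D) * eps = 45 / 26 * (N * eps ^+ 2) * D by ring.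
  by rewrite ler_pM2r // ler_wpM2l.
have Ne : 0 <= N * eps by rewrite mulr_ge0 // ltW.
have : N * eps * 2 <= N * eps * D by rewrite ler_wpM2l.
set W := N * eps * D in hT *; set V := N * eps in Ne *.
have -> : V * (D * (1 / 3 + 1 / 48 + 4 / 3) + 31 / 48) =
  W * (1 / 3 + 1 / 48 + 4 / 3) + V * (31 / 48) by rewrite /V /W; ring.
have -> : N * (1 - eps) * (15 / 4 * D) = N * (15 / 4 * D) - 15 / 4 * W.
  by rewrite /W; ring.
lra.
Qed.

Lemma dotv_mulmx (R : realType) (d : nat) (u v : 'cV[R]_d) (C : 'M[R]_d) :
  dotv u (C *m v) = \sum_j dotv u (col j C) * v j 0.
Proof.
rewrite /dotv; under eq_bigr do rewrite mxE mulr_sumr.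
rewrite exchange_big /=; apply: eq_bigr => j _; rewrite mulr_suml.
by apply: eq_bigr => i _; rewrite mxE mulrA.
Qed.

Lemma quadformBZ (R : realType) (d : nat) (A B : 'M[R]_d) (c : R) (a : 'cV[R]_d) :
  quadform (A - c *: B) a = quadform A a - c * quadform B a.
Proof.
by rewrite !quadformE mulr_sumr -sumrB; apply: eq_bigr => i _;
  rewrite mulr_sumr -sumrB; apply: eq_bigr => j _; rewrite !mxE; ring.
Qed.

Theorem theorem3p3 (R : realType) (d n : nat)
  (dispS : measure_display) (S : measurableType dispS) (Q : probability S R)
  (dispT : measure_display) (T : measurableType dispT) (P : probability T R)
  (w : {RV Q >-> d.-tuple R}) (ws : 'I_n -> {RV P >-> d.-tuple R})
  (beta eps p : R)
  (hd : (2 <= d)%N)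
  (hmoments : forall k : nat, (k <= 4)%N ->
    ('E_Q[fun s => (normv (colv (w s)) ^+ k)%R] < +oo)%E)
  (hcentered : forall j : 'I_d, ('E_Q[fun s => colv (w s) j 0%R] = 0)%E)
  (hrank : \rank (covmx w) = d)
  (hbeta : 1 <= beta)
  (hvar : forall a : 'cV[R]_d,
    ('V_Q[fun s => (dotv (colv (w s)) a ^+ 2)%R]
       <= (beta ^+ 2)%:E * 'V_Q[fun s => dotv (colv (w s)) a] ^+ 2)%E)
  (heps : 0 < eps < 1)
  (hp : 0 < p < 1)
  (hn : 26 * beta ^+ 2 * Num.max d%:R (ln (d%:R / p)) / eps ^+ 2 <= n%:R)
  (hiid : iid_copies w ws) :
  ((1 - p)%:E <=
   P [set t | forall a : 'cV[R]_d,
        (1 - eps) * quadform (covmx w) a <= quadform (sample_covmx ws t) a]%R)%E.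
Proof.
have hmom4 := hmoments 4%N (leqnn 4).
case/andP: heps => e0 e1; case/andP: hp => p0 p1.
pose D : R := d%:R; pose H : R := 2 * beta ^+ 2; pose m := Num.max D (ln (D / p)).
pose K := covmx w.
have D2 : 2 <= D by rewrite ler_nat.
have D0 : 0 < D by lra.
have b2 : 1 <= beta ^+ 2 by rewrite exprn_ege1.
have H0 : 0 < H by rewrite /H; lra.
have Dm : D <= m by rewrite le_max lexx.
have lpm : - ln p <= m.
  rewrite le_max; apply/orP; right; rewrite ln_div ?posrE //.
  by rewrite lerDr ln_ge0 //; lra.
have hN : 13 * H * m <= n%:R * eps ^+ 2.
  move: hn; rewrite ler_pdivrMr ?exprn_gt0 //; apply: le_trans.
  by rewrite /H /m /D; lra.
have n0 : 0 < n%:R :> R.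
  rewrite lt_neqAle ler0n andbT eq_sym; apply: contraTneq hN => ->.
  by rewrite mul0r -ltNge !mulr_gt0 //; lra.
have symK : K^T = K.
  apply/matrixP => i j; rewrite !mxE; congr fine; congr expectation.
  by apply/funext => s; rewrite !mxE !big_ord1 !mxE mulrC.
have uK : K \in unitmx by rewrite -row_free_unit /row_free hrank.
have psdK (a : 'cV[R]_d) : 0 <= (a^T *m K *m a) 0 0.
  exact: (quadform_covmx_ge0 hmom4).
(* Full rank enters here, upgrading the semidefinite covariance to a definite one. *)
have [C CE] := posdef_whitening symK (posdef_of_psd symK uK psdK).
have uC : C \in unitmx by have [] := mulmx1_unit CE.
have KC v : quadform K (C *m v) = \sum_j v j 0 ^+ 2.
  have -> : quadform K (C *m v) = (v^T *m v) 0 0.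
    rewrite /quadform trmx_mul.
    have -> : v^T *m C^T *m K *m (C *m v) = v^T *m (C^T *m K *m C) *m v.
      by rewrite !mulmxA.
    by rewrite CE mulmx1.
  by rewrite mxE; apply: eq_bigr => j _; rewrite mxE expr2.
(* [lambda] nearly minimises the loss in [final_constants], and [M] is then the
   largest value with [lambda * M * delta <= 1 / 2]. *)
pose lambda := eps / (6 * H * D); pose M := 12 * H / eps; pose delta := D / 4.
have la0 : 0 < lambda by rewrite divr_gt0 // ?mulr_gt0 //; lra.
have M0 : 0 < M by rewrite divr_gt0 // mulr_gt0 //; lra.
have de0 : 0 < delta by rewrite /delta; lra.
have lMd : lambda * M * delta <= 2^-1.
  suff -> : lambda * M * delta = 2^-1 by [].
  by rewrite /lambda /M /delta; field; rewrite !gt_eqF.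
(* [X y] holds the whitened coordinates, and [bb y] is their mean square, of expectation 1. Since
   [delta = D / 4], [bb y * delta] is a quarter of the squared norm. *)
pose X (y : d.-tuple R) (j : 'I_d) := dotv (colv y) (col j C).
pose bb (y : d.-tuple R) := (\sum_j X y j ^+ 2) / D.
pose U (k : 'I_d -> int) (y : d.-tuple R) := (\sum_j X y j * (k j)%:~R) ^+ 2.
pose kv (k : 'I_d -> int) : 'cV[R]_d := \col_j (k j)%:~R.
have UE k y : U k y = dotv (colv y) (C *m kv k) ^+ 2.
  rewrite /U dotv_mulmx; congr (_ ^+ 2); apply: eq_bigr => j _.
  by rewrite !mxE.
pose G k y := lambda * ((U k y - bb y * delta) / (1 + bb y / M)).
pose s2 (k : 'I_d -> int) : R := \sum_j (k j)%:~R ^+ 2.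
have s20 k : 0 <= s2 k by apply: sumr_ge0 => j _; exact: sqr_ge0.
pose mu k := lambda * (s2 k * (1 - H / M) - delta)
     - lambda ^+ 2 * H * (s2 k ^+ 2 / 2 + 2 * delta ^+ 2).
pose sk (k : 'I_d -> int) := - ln p + d%:R * ln 3 + ln 2 * \sum_j `|(k j)%:~R| : R.
have colC j : col j C = C *m delta_mx j 0 by rewrite colE.
have qC j : quadform K (col j C) = 1.
  rewrite colC KC (bigD1 j) //= mxE !eqxx expr1n big1 ?addr0 // => i ij.
  by rewrite mxE (negPf ij) expr0n.
have qk k : quadform K (C *m kv k) = s2 k.
  by rewrite KC; apply: eq_bigr => j _; rewrite mxE.
have E4 (a : 'cV[R]_d) : ('E_Q[fun s => (dotv (colv (w s)) a ^+ 4)%R] <=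
    (H * quadform K a ^+ 2)%:E)%E by exact: expectation_dotv4_le.
have mX j : measurable_fun setT (fun y => X y j) by exact: measurable_dotv.
have mXX j : measurable_fun setT (fun y => X y j ^+ 2) by exact: measurable_funX.
have mbb : measurable_fun setT bb.
  by apply: measurable_funM => //; apply: measurable_sum.
have mU k : measurable_fun setT (U k).
  by apply: measurable_funX; apply: measurable_sum => j; exact: measurable_funM.
have bb0 y : 0 <= bb y.
  by rewrite divr_ge0 ?(ltW D0) // sumr_ge0 // => j _; exact: sqr_ge0.
have U0 k y : 0 <= U k y by exact: sqr_ge0.
have tau0 y : 0 < 1 + bb y / M by rewrite ltr_pwDl // divr_ge0 // ltW.
have mG k : measurable_fun setT (G k).
  apply: measurable_funM => //; apply: measurable_funM.
    by apply: measurable_funB => //; exact: measurable_funM.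
  apply: measurable_inv_gt0 => //.
  by apply: measurable_funD => //; exact: measurable_funM.
(* The truncation caps the negative part of [G] at [lambda * M * delta], giving the uniform lower
   bound asked for by the Chernoff estimate. *)
have Glb k y : - 2^-1 <= G k y.
  have tb := truncation_le (bb0 y) M0; rewrite /G; move: (tau0 y) tb (U0 k y).
  rewrite -invr_gt0; set t := (1 + bb y / M)^-1 => t0 tb u0.
  have -> : lambda * ((U k y - bb y * delta) * t) =
    lambda * (U k y * t) - lambda * delta * (bb y * t) by ring.
  have h1 : 0 <= lambda * (U k y * t).
    by apply: mulr_ge0; [exact: ltW | apply: mulr_ge0 => //; exact: ltW].
  have h2 : lambda * delta * (bb y * t) <= lambda * delta * M.
    by apply: ler_wpM2l => //; apply: mulr_ge0; exact: ltW.
  have h3 : lambda * delta * M = lambda * M * delta by ring.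
  lra.
have mw (f : d.-tuple R -> R) : measurable_fun setT f ->
    measurable_fun setT (fun s => f (w s)).
  by move=> mf; exact: (measurableT_comp mf (measurable_funPT w)).
have EG k : ('E_Q[fun s => (expR (- G k (w s)))%R] <= (expR (- mu k))%:E)%E.
  apply: (truncated_mgf_le (U := fun s => U k (w s)) (b := fun s => bb (w s)))
    => //; rewrite ?(ltW H0) ?(ltW de0) ?(ltW la0) //; try exact: mw.
  - move=> /eqP; rewrite psumr_eq0 => [/allP k0 s|j _]; last exact: sqr_ge0.
    rewrite /U big1 ?expr0n // => j _; have := k0 j (mem_index_enum j).
    by rewrite /= sqrf_eq0 => /eqP ->; rewrite mulr0.
  - under eq_fun do rewrite UE.
    by rewrite (expectation_dotv2 hmom4) qk.
  - rewrite -qk; under eq_fun do rewrite UE -exprM.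
    exact: E4.
  - rewrite /bb; under eq_fun do rewrite mulrC.
    rewrite ge0_expectationZl ?invr_ge0 ?(ltW D0) //; last 2 first.
    + by apply: measurable_sum => j; exact: (mw _ (mXX j)).
    + by move=> s; apply: sumr_ge0 => j _; exact: sqr_ge0.
    rewrite ge0_expectation_sum //; last 2 first.
    + by move=> j; exact: (mw _ (mXX j)).
    + by move=> j s; exact: sqr_ge0.
    under eq_bigr do rewrite (expectation_dotv2 hmom4) qC.
    by rewrite sumEFin -EFinM sumr_const card_ord mulVf // gt_eqF.
  (* By Cauchy-Schwarz the squared average of the [X j ^+ 2] is at most the average of the
     [X j ^+ 4], each of expectation at most [H]. *)
  - have mX4 j : measurable_fun setT (fun s => X (w s) j ^+ 4).
      by apply: measurable_funX; exact: (mw _ (mX j)).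
    have X40 j y : 0 <= X y j ^+ 4 by rewrite -[4%N]/(2 * 2)%N exprM sqr_ge0.
    have Di0 : 0 <= D^-1 by rewrite invr_ge0 ltW.
    apply: (@le_trans _ _ ('E_Q[fun s => (D^-1 * \sum_j X (w s) j ^+ 4)%R])%E).
      apply: ge0_expectation_le.
      + by apply: measurable_funX; exact: (mw _ mbb).
      + by move=> s; exact: sqr_ge0.
      + by apply: measurable_funM => //; exact: measurable_sum.
      move=> s; rewrite /bb expr_div_n ler_pdivrMr ?exprn_gt0 //.
      have -> : D^-1 * (\sum_j X (w s) j ^+ 4) * D ^+ 2 =
          (\sum_j X (w s) j ^+ 4) * D.
        by field; rewrite gt_eqF.
      have := sum_mul_sqr_le (fun j => X (w s) j ^+ 2) (fun=> 1).
      under eq_bigr do rewrite mulr1.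
      under [X in _ <= X * _ -> _]eq_bigr do rewrite -exprM.
      by rewrite expr1n sumr_const card_ord.
    rewrite ge0_expectationZl //; last 2 first.
    + exact: measurable_sum.
    + by move=> s; apply: sumr_ge0.
    rewrite ge0_expectation_sum //.
    have -> : H%:E = (D^-1%:E * \sum_(j < d) H%:E)%E.
      rewrite sumEFin -EFinM sumr_const card_ord -[H *+ d]mulr_natl mulKf //.
      by rewrite gt_eqF.
    apply: lee_wpmul2l; first by rewrite lee_fin.
    by apply: lee_sum => j _; apply: le_trans (E4 _) _; rewrite qC expr1n mulr1.
have tail k : (P [set t | (\sum_i G k (ws i t) < n%:R * mu k - sk k)%R] <=
    (expR (- sk k))%:E)%E by apply: (iid_chernoff hiid (c := 2^-1)).
(* The bad events run over the box of half-width [2 * d + 2], which contains every rounding used on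
   the sphere. *)
pose A (g : {ffun 'I_d -> 'I_(2 * (2 * d + 2)).+1}) :=
  [set t | (\sum_i G (box_point g) (ws i t) <
    n%:R * mu (box_point g) - sk (box_point g))%R].
have mA g : measurable (A g).
  rewrite (_ : A g = (fun t => \sum_i G (box_point g) (ws i t)) @^-1`
      `]-oo, (n%:R * mu (box_point g) - sk (box_point g))[%classic).
    rewrite -[X in measurable X]setTI; apply: measurable_sum => // i.
    exact: (measurableT_comp (mG _) (measurable_funPT (ws i))).
  by apply/seteqP; split => t /=; rewrite in_itv.
have PA : (P (\bigcup_g A g) <= p%:E)%E.
  apply: le_trans (measure_bigcup_le_sum P mA) _.
  apply: (@le_trans _ _ (\sum_g (p * \prod_j
      (3^-1 * 2^-1 ^+ `|box_point g j|%N))%:E)%E).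
    by apply: lee_sum => g _; rewrite -expRN_box_weight //; exact: tail.
  rewrite sumEFin lee_fin -mulr_sumr -[leRHS]mulr1 ler_pM2l //.
  exact: box_weight_sum_le1.
have mU_ : measurable (\bigcup_g A g) by exact: fin_bigcup_measurable.
apply: (@le_trans _ _ (P (~` \bigcup_g A g))).
  rewrite probability_setC // EFinB leeB //.
apply: le_measure; rewrite ?inE.
- exact: measurableC.
(* Monotonicity of [P] needs the target event to be measurable; it says that a random matrix is
   positive semidefinite. *)
- rewrite (_ : [set t | _] = [set t | forall a : 'cV[R]_d,
      0 <= quadform (sample_covmx ws t - (1 - eps) *: K) a]); last first.
    apply/seteqP; split => t /= h a; have := h a;
    by rewrite quadformBZ subr_ge0.
  apply: measurable_quadform_ge0 => i j.
  have -> : (fun t => (sample_covmx ws t - (1 - eps) *: K) i j) = (fun t =>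
      n%:R^-1 * \sum_l (tnth (ws l t) i * tnth (ws l t) j) - (1 - eps) * K i j).
    apply/funext => t; rewrite !mxE summxE; congr (_ * _ - _).
    by apply: eq_bigr => l _; rewrite mxE big_ord1 !mxE.
  have mt l q : measurable_fun setT (fun t => tnth (ws l t) q).
    exact: (measurableT_comp (measurable_tnth q) (measurable_funPT (ws l))).
  apply: measurable_funB => //; apply: measurable_funM => //.
  by apply: measurable_sum => l; exact: measurable_funM.
move=> t At /=.
pose x i j := X (ws i t) j.
pose tau i := (1 + bb (ws i t) / M)^-1.
have tau01 i : 0 <= tau i <= 1.
  rewrite /tau invr_ge0 (ltW (tau0 _)) invf_le1 ?tau0 //= lerDl.
  by rewrite divr_ge0 // ltW.
have sphere v : \sum_j v j ^+ 2 = 15 / 4 * d%:R ->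
   n%:R * (1 - eps) * (15 / 4 * D) <= \sum_i (\sum_j x i j * v j) ^+ 2.
  move=> v2.
  (* The truncation factors are at most 1 and the squares nonnegative, so the truncated sum is a
     lower bound. *)
  apply: (@le_trans _ _ (\sum_i tau i * (\sum_j x i j * v j) ^+ 2)); last first.
    apply: ler_sum => i _; have /andP[_ t1] := tau01 i.
    by rewrite ler_piMl ?sqr_ge0.
  (* The coefficients come from dividing [n%:R * mu k - sk k] by [lambda] and collecting the norms
     of [k]. *)
  apply: le_trans (lattice_to_sphere (tau := tau) (x := x)
    (a := n%:R * (1 - H / M))
    (b := n%:R * delta + 2 * n%:R * lambda * H * delta ^+ 2 +
          (- ln p + D * ln 3) / lambda)
    (c := n%:R * lambda * H / 2) (e := ln 2 / lambda) _ _ _ _ v2).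
  - exact: (final_constants (ltW n0) D2 e0 H0 Dm lpm (ln12_le R) hN).
  - by move=> i; have /andP[] := tau01 i.
  - by rewrite divr_ge0 // mulr_ge0 ?(ltW H0) // mulr_ge0 // ltW.
  - by rewrite divr_ge0 ?(ltW la0) // ln_ge0 // ler1n.
  move=> k hk; have [g gk] := box_pointP hk.
  have bk : box_point g = k by apply/funext.
  have : n%:R * mu k - sk k <= \sum_i G k (ws i t).
    rewrite leNgt; apply/negP => h; apply: At; exists g => //.
    by rewrite /A /= bk.
  have -> : \sum_i G k (ws i t) = lambda * (\sum_i tau i *
      ((\sum_j x i j * (k j)%:~R) ^+ 2 - (\sum_j x i j ^+ 2) / 4)).
    rewrite mulr_sumr; apply: eq_bigr => i _; rewrite /G /tau /U /bb /x /delta.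
    congr (_ * _); rewrite [RHS]mulrC; congr (_ * _); congr (_ - _).
    by field; rewrite gt_eqF.
  rewrite -ler_pdivrMl //; apply: le_trans.
  rewrite le_eqVlt; apply/orP; left; apply/eqP.
  rewrite /mu /sk -/(s2 k) -/D; set r := \sum_j `|_|.
  by field; rewrite !gt_eqF.
move=> a; rewrite quadform_sample_covmx.
pose v := invmx C *m a.
have aE : a = C *m v by rewrite mulKVmx.
pose r := \sum_j v j 0 ^+ 2.
rewrite -/K [in leLHS]aE KC -/r.
have -> : \sum_i dotv (colv (ws i t)) a ^+ 2 =
    \sum_i (\sum_j x i j * v j 0) ^+ 2.
  by apply: eq_bigr => i _; rewrite aE dotv_mulmx.
have r0 : 0 <= r by apply: sumr_ge0 => j _; exact: sqr_ge0.
rewrite [leRHS]mulrC ler_pdivlMr //.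
(* If [r = 0] the left side vanishes; otherwise homogeneity allows rescaling [v] by [kap] to squared
   norm [15 / 4 * D]. *)
have [->|rn0] := eqVneq r 0.
  by rewrite mulr0 mul0r sumr_ge0 // => i _; exact: sqr_ge0.
have rpos : 0 < r by rewrite lt_neqAle eq_sym rn0.
pose kap := Num.sqrt (15 / 4 * D / r).
have kap2 : kap ^+ 2 = 15 / 4 * D / r.
  by rewrite sqr_sqrtr // divr_ge0 // mulr_ge0 // ltW.
have /sphere : \sum_j (kap * v j 0) ^+ 2 = 15 / 4 * d%:R.
  under eq_bigr do rewrite exprMn.
  by rewrite -mulr_sumr -/r kap2 divfK.
have -> : \sum_i (\sum_j x i j * (kap * v j 0)) ^+ 2 =
    15 / 4 * D / r * \sum_i (\sum_j x i j * v j 0) ^+ 2.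
  rewrite mulr_sumr -kap2; apply: eq_bigr => i _; rewrite -exprMn; congr (_ ^+ 2).
  by rewrite mulr_sumr; apply: eq_bigr => j _; rewrite mulrCA.
have c0 : 0 < 15 / 4 * D by rewrite mulr_gt0.
rewrite [X in _ <= X -> _]mulrAC ler_pdivlMr // => h.
rewrite -(ler_pM2l c0); apply: le_trans h.
by rewrite le_eqVlt; apply/orP; left; apply/eqP; ring.
Qed.
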